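(* Let $\alpha\in(0,1]$ and $\beta=\sqrt{1-\alpha^2}$. The set of nonconstant solutions $f:\mathbb{R}\to\mathbb{S}^2$ to $$\frac{x f'}{2}=\beta f\times f''-\alpha f\times(f\times f'')\quad\text{on }\mathbb{R}$$ is $\{\mathcal{R}\, m_{c,\alpha} : c>0,\ \mathcal{R}\in SO(3)\}$.
   Context: $\mathbb{S}^2$ is the unit sphere in $\mathbb{R}^3$, $\times$ is the cross product, and $SO(3)$ is the group of orientation-preserving rotations about the origin. For $c>0$, $m_{c,\alpha}$ denotes the first vector of the unique global smooth solution $(m,n,b)$, with $m,n,b:\mathbb{R}\to\mathbb{R}^3$, of the Serret--Frenet system $$m'=k\,n,\qquad n'=-k\,m+\tau\, b,\qquad b'=-\tau\, n,$$ with $k(x)=c\,e^{\alpha x^2/4}$, $\tau(x)=-\beta x/2$ and initial conditions $m(0)=(1,0,0)$, $n(0)=(0,1,0)$, $b(0)=(0,0,1)$. Solutions are understood in the following weak sense. For $f$ with $|f|=1$ the equation is rewritten as $\alpha f''+\alpha|f'|^2f+\beta(f\times f')'-\frac{xf'}{2}=0$, and a solution is a function $f\in H^1_{\mathrm{loc}}(\mathbb{R};\mathbb{S}^2)$ (identified with its continuous representative) with $$\int_{\mathbb{R}}\Big(-\alpha f'\cdot\varphi'+\alpha|f'|^2 f\cdot\varphi-\beta(f\times f')\cdot\varphi'-\frac{x}{2}f'\cdot\varphi\Big)\,dx=0\quad\text{for all }\varphi\in C_0^\infty(\mathbb{R};\mathbb{R}^3).$$ *)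

(* Defs.v *)
From HB Require Import structures.
From mathcomp Require Import all_boot all_order all_algebra.
From mathcomp Require Import all_classical all_reals all_analysis.

Set Implicit Arguments.
Unset Strict Implicit.
Unset Printing Implicit Defensive.
Import Order.TTheory GRing.Theory Num.Theory.
Import numFieldNormedType.Exports.
Local Open Scope ring_scope.
Local Open Scope classical_set_scope.

(* The norm `|_| on matrices is the sup norm, hence the Euclidean structure
   is given here by the scalar product; |v|^2 is written dotv v v. *)
Definition dotv (R : realType) (u v : 'cV[R]_3) : R := \sum_i u i 0 * v i 0.

(* i + 1 and i + 2 are taken in 'I_3, i.e., modulo 3. *)
Definition crossv (R : realType) (u v : 'cV[R]_3) : 'cV[R]_3 :=
  \col_i (u (i + 1) 0 * v (i + 2) 0 - u (i + 2) 0 * v (i + 1) 0).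

Definition S2 (R : realType) : set 'cV[R]_3 := [set v | dotv v v = 1].

Definition SO3 (R : realType) : set 'M[R]_3 :=
  [set Q | Q^T *m Q = 1%:M /\ \det Q = 1].

Definition smooth (R : realType) (V : normedModType R) (f : R -> V) : Prop :=
  forall (n : nat) (x : R), derivable (f^`(n)) x 1.

(* The space of smooth functions from R to V with compact support. *)
Definition test_function (R : realType) (V : normedModType R) (phi : R -> V) :=
  smooth phi /\ compact (closure [set x | phi x != 0]).

Definition L2loc (R : realType) (g : R -> 'cV[R]_3) : Prop :=
  forall i, measurable_fun setT (fun x => g x i 0) /\
            locally_integrable setT (fun x => g x i 0 ^+ 2).

(* Both sides are meaningful as soon as f and g are locally integrable, which
   is the only case in which this is used. *)
Definition weak_derivative (R : realType) (f g : R -> 'cV[R]_3) : Prop :=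
  forall (i : 'I_3) (phi : R -> R), test_function phi ->
    \int[lebesgue_measure]_x (f x i 0 * phi^`()%classic x) =
    - \int[lebesgue_measure]_x (g x i 0 * phi x).

(* f belongs to H^1_loc(R; S^2), is its own continuous representative, and has
   weak derivative df. *)
Definition H1loc_S2 (R : realType) (f df : R -> 'cV[R]_3) : Prop :=
  [/\ continuous f, forall x, S2 (f x), L2loc f, L2loc df
    & weak_derivative f df].

(* Weak form of
   alpha f'' + alpha |f'|^2 f + beta (f x f')' - x f' / 2 = 0,
   which is x f' / 2 = beta f x f'' - alpha f x (f x f'') when |f| = 1.
   The weak derivative df is unique up to a null set. *)
Definition weak_solution (R : realType) (alpha beta : R) (f : R -> 'cV[R]_3) :=
  exists2 df : R -> 'cV[R]_3, H1loc_S2 f df &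
    forall phi : R -> 'cV[R]_3, test_function phi ->
      \int[lebesgue_measure]_x
        (- (alpha * dotv (df x) (phi^`()%classic x))
         + alpha * dotv (df x) (df x) * dotv (f x) (phi x)
         - beta * dotv (crossv (f x) (df x)) (phi^`()%classic x)
         - x / 2 * dotv (df x) (phi x)) = 0.

Definition curvature (R : realType) (c alpha x : R) : R :=
  c * expR (alpha * x ^+ 2 / 4).

Definition torsion (R : realType) (beta x : R) : R := - (beta * x / 2).

Definition serret_frenet (R : realType) (c alpha beta : R)
    (m n b : R -> 'cV[R]_3) : Prop :=
  [/\ [/\ smooth m, smooth n & smooth b],
      forall x : R,
        [/\ m^`() x = curvature c alpha x *: n x,
            n^`() x = - curvature c alpha x *: m x + torsion beta x *: b x
          & b^`() x = - torsion beta x *: n x]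
    & [/\ m 0 = delta_mx 0 0, n 0 = delta_mx 1 0 & b 0 = delta_mx 2 0]].

(* The first vector of the unique solution of the Serret-Frenet system; the
   default value 0 of xget would only be taken if there were no solution. *)
Definition frenet_m (R : realType) (c alpha beta : R) : R -> 'cV[R]_3 :=
  xget (fun=> 0) [set m | exists n b, serret_frenet c alpha beta m n b].

(* Main.v *)
Require Import Defs.
From HB Require Import structures.
From mathcomp Require Import all_boot all_order all_algebra.
From mathcomp Require Import all_classical all_reals all_analysis.
From mathcomp Require Import measurable_realfun.
From mathcomp Require Import ring lra.
Import Order.TTheory GRing.Theory Num.Theory.
Import numFieldNormedType.Exports.
Local Open Scope ring_scope.
Local Open Scope classical_set_scope.

(** The equation is in divergence form: with [G = alpha f' + beta f x f'] it
    reads [G' = x f' / 2 - alpha |f'|^2 f]. Testing it against differences of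
    smooth steps shows that [G] is a.e. equal to a continuous function (du
    Bois-Reymond). Since [f . f' = 0] a.e. and [alpha^2 + beta^2 = 1], one has
    [f' = alpha G - beta f x G] a.e., whence [f] and [G] are C^1. Then
    [f . G = 0], [|f'| = |G|] and [(|G|^2)' = alpha x |G|^2], so that
    [|f'| = c exp (alpha x^2 / 4)] for some [c >= 0]. If [c = 0], [f] is
    constant; if [c > 0], the frame [(f, f'/|f'|, f x f'/|f'|)] solves the
    Serret-Frenet system, and uniqueness identifies it with the rotation of the
    standard frame by its initial value. Conversely, along a rotated
    Serret-Frenet frame the integrand of the weak form is the derivative of the
    compactly supported function [- G . phi]. *)

(** * Vectors in dimension 3 *)

(** The regularity argument works at Lebesgue points, where the chosen representatives are the
    limits of their averages. At such a point [f], being a constant plus the primitive of [df], is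
    classically differentiable, so that [|f| = 1] yields [f . df = 0] pointwise, without a product
    rule for Sobolev functions. On the plane orthogonal to a unit vector [u], the map [crossv u] is
    a quarter turn; thus [d |-> alpha d + beta u x d] is a rotation of that plane, and the opposite
    rotation inverts it. This recovers [f'] from [G] by algebra alone. The curve in the theorem is
    selected by [xget], and it is meaningful only once the Frenet system is known to have a global
    solution: hence the part on linear equations, where a series of iterated integrals is compared
    with the exponential series. Uniqueness is cheaper: the coefficient matrix is skew, so the sum
    of squared lengths of the difference of two solutions is constant. *)

Section vec3.
Context {R : realType}.
Implicit Types u v w : 'cV[R]_3.

Lemma ord3P (P : 'I_3 -> Prop) : P 0 -> P 1 -> P 2%:R -> forall i, P i.
Proof.
move=> P0 P1 P2 [[|[|[|//]]] Hi]; first by congr P: P0; apply/val_inj.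
  by congr P: P1; apply/val_inj.
by congr P: P2; apply/val_inj.
Qed.

Lemma cv3P u v : u 0 0 = v 0 0 -> u 1 0 = v 1 0 -> u 2%:R 0 = v 2%:R 0 -> u = v.
Proof. by move=> *; apply/colP; apply: ord3P. Qed.

Lemma dotvE u v :
  dotv u v = u 0 0 * v 0 0 + u 1 0 * v 1 0 + u 2%:R 0 * v 2%:R 0.
Proof.
rewrite /dotv !big_ord_recr big_ord0 /= add0r.
by congr (_ * _ + _ * _ + _ * _); (congr (u _ _) || congr (v _ _)); apply/val_inj.
Qed.

Lemma crossv0E u v : crossv u v 0 0 = u 1 0 * v 2%:R 0 - u 2%:R 0 * v 1 0.
Proof.
rewrite mxE; congr (u _ _ * v _ _ - u _ _ * v _ _); exact/val_inj.
Qed.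

Lemma crossv1E u v : crossv u v 1 0 = u 2%:R 0 * v 0 0 - u 0 0 * v 2%:R 0.
Proof.
rewrite mxE; congr (u _ _ * v _ _ - u _ _ * v _ _); exact/val_inj.
Qed.

Lemma crossv2E u v : crossv u v 2%:R 0 = u 0 0 * v 1 0 - u 1 0 * v 0 0.
Proof.
rewrite mxE; congr (u _ _ * v _ _ - u _ _ * v _ _); exact/val_inj.
Qed.

Definition cross_coordE := (crossv0E, crossv1E, crossv2E).

Lemma dotvC u v : dotv u v = dotv v u.
Proof. by rewrite !dotvE; ring. Qed.

Lemma dotv_ge0 v : 0 <= dotv v v.
Proof. by rewrite dotvE !addr_ge0// -expr2 sqr_ge0. Qed.

Lemma dotv_eq0 v : dotv v v = 0 -> v = 0.
Proof.
rewrite dotvE => v0; apply: cv3P; rewrite mxE; nra.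
Qed.

Lemma addvE p (a b : 'cV[R]_p) i : (a + b) i 0 = a i 0 + b i 0.
Proof. by rewrite mxE. Qed.
Lemma oppvE p (a : 'cV[R]_p) i : (- a) i 0 = - a i 0.
Proof. by rewrite mxE. Qed.
Lemma scalevE p c (a : 'cV[R]_p) i : (c *: a) i 0 = c * a i 0.
Proof. by rewrite mxE. Qed.

Lemma crossvDr u v w : crossv u (v + w) = crossv u v + crossv u w.
Proof. by apply/colP => i; rewrite !mxE; ring. Qed.

Lemma crossvZr u c v : crossv u (c *: v) = c *: crossv u v.
Proof. by apply/colP => i; rewrite !mxE; ring. Qed.

Lemma crossvC u v : crossv u v = - crossv v u.
Proof. by apply/colP => i; rewrite !mxE; ring. Qed.

Lemma double_cross u v w :
  crossv u (crossv v w) = dotv u w *: v - dotv u v *: w.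
Proof.
by apply: cv3P; rewrite !(addvE, oppvE, scalevE) !cross_coordE !dotvE; ring.
Qed.

Lemma crossvv u : crossv u u = 0.
Proof. by apply/colP => i; rewrite !mxE; ring. Qed.

Lemma crossvNr u v : crossv u (- v) = - crossv u v.
Proof. by apply/colP => i; rewrite !mxE; ring. Qed.

Lemma dotvDr u v w : dotv u (v + w) = dotv u v + dotv u w.
Proof. by rewrite !dotvE !addvE; ring. Qed.

Lemma dotvZr u c v : dotv u (c *: v) = c * dotv u v.
Proof. by rewrite !dotvE !scalevE; ring. Qed.

Lemma dotvNr u v : dotv u (- v) = - dotv u v.
Proof. by rewrite !dotvE !oppvE; ring. Qed.

Lemma dotv_cross_self u v : dotv u (crossv u v) = 0.
Proof. by rewrite !dotvE !cross_coordE; ring. Qed.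

Lemma dotv_cross_cross u v :
  dotv (crossv u v) (crossv u v) = dotv u u * dotv v v - dotv u v ^+ 2.
Proof. by rewrite !dotvE !cross_coordE; ring. Qed.

(* [w] is [v] rotated about [u] by the angle of cosine [a] and sine [- b]. *)
Lemma dotv_rotation (a b : R) u v : a ^+ 2 + b ^+ 2 = 1 -> dotv u u = 1 ->
  dotv u v = 0 ->
  let w := a *: v - b *: crossv u v in
  [/\ dotv w w = dotv v v, dotv u w = 0 & dotv v w = a * dotv v v].
Proof.
move=> ab uu uv w.
have vc : dotv v (crossv u v) = 0 by rewrite !dotvE !cross_coordE; ring.
have cc : dotv (crossv u v) (crossv u v) = dotv v v.
  by rewrite dotv_cross_cross uu uv; ring.
split; rewrite /w.
- rewrite dotvDr dotvZr dotvNr dotvZr ![dotv (_ + _) _]dotvC.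
  rewrite !dotvDr !dotvZr !dotvNr !dotvZr ![dotv (crossv u v) v]dotvC vc cc.
  by rewrite -[RHS]mul1r -ab; ring.
- by rewrite dotvDr dotvZr dotvNr dotvZr uv dotv_cross_self; ring.
- by rewrite dotvDr dotvZr dotvNr dotvZr vc; ring.
Qed.

(** On the plane orthogonal to [u], [crossv u] squares to minus the identity, so this is the complex
    identity [(alpha - i beta)(alpha + i beta) = 1]. *)
Lemma flux_inversion (alpha beta : R) u d : alpha ^+ 2 + beta ^+ 2 = 1 ->
  dotv u u = 1 -> dotv u d = 0 ->
  let g := alpha *: d + beta *: crossv u d in
  alpha *: g - beta *: crossv u g = d.
Proof.
move=> ab uu ud /=.
rewrite crossvDr !crossvZr double_cross ud uu scale0r scale1r sub0r.
apply/colP => i; rewrite !(addvE, oppvE, scalevE).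
by rewrite -[RHS]mul1r -ab; ring.
Qed.

End vec3.

(** * Derivatives and primitives *)

Section calculus.
Context {R : realType}.
Implicit Types (f g : R -> R) (x : R).

Lemma is_derive_mxP n (f : R -> 'cV[R]_n) x (df : 'cV[R]_n) :
  is_derive x 1 f df <->
  forall i, is_derive x 1 (fun t => f t i 0) (df i 0).
Proof.
split=> [[Df dfE] i|H].
  apply: DeriveDef; first by have /derivable_mxP := Df.
  by move: dfE; rewrite derive_mx// => <-; rewrite mxE.
have Df : derivable f x 1.
  by apply/derivable_mxP => i j; rewrite ord1; case: (H i).
apply: DeriveDef => //; rewrite derive_mx//; apply/colP => i; rewrite mxE.
by case: (H i).
Qed.

Lemma is_derive_scalev n (k : R -> R) (f : R -> 'cV[R]_n) x dk df :
  is_derive x 1 k dk -> is_derive x 1 f df ->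
  is_derive x 1 (fun t => k t *: f t) (dk *: f x + k x *: df).
Proof.
move=> Hk /is_derive_mxP Hf; apply/is_derive_mxP => i; rewrite !mxE.
have Hi := Hf i.
rewrite (_ : (fun t => _) = (k * (fun t => f t i 0))); last first.
  by apply/funext => t; rewrite mxE.
by apply: is_derive_eq; rewrite /GRing.scale/=; ring.
Qed.

Lemma is_derive_dotv (f g : R -> 'cV[R]_3) x df dg :
  is_derive x 1 f df -> is_derive x 1 g dg ->
  is_derive x 1 (fun t => dotv (f t) (g t)) (dotv df (g x) + dotv (f x) dg).
Proof.
move=> /is_derive_mxP Hf /is_derive_mxP Hg.
have [f0 f1 f2] := And3 (Hf 0) (Hf 1) (Hf 2%:R).
have [g0 g1 g2] := And3 (Hg 0) (Hg 1) (Hg 2%:R).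
rewrite (_ : (fun t => _) = ((fun t => f t 0 0) * (fun t => g t 0 0) +
   (fun t => f t 1 0) * (fun t => g t 1 0) +
   (fun t => f t 2%:R 0) * (fun t => g t 2%:R 0))); last first.
  by apply/funext => t; rewrite dotvE.
apply: (is_derive_eq
  (is_deriveD (is_deriveD (is_deriveM f0 g0) (is_deriveM f1 g1)) (is_deriveM f2 g2))).
by rewrite !dotvE /GRing.scale/=; ring.
Qed.

Lemma is_derive_crossv (f g : R -> 'cV[R]_3) x df dg :
  is_derive x 1 f df -> is_derive x 1 g dg ->
  is_derive x 1 (fun t => crossv (f t) (g t)) (crossv df (g x) + crossv (f x) dg).
Proof.
move=> /is_derive_mxP Hf /is_derive_mxP Hg; apply/is_derive_mxP => i.
have fi := Hf (i + 1); have fj := Hf (i + 2).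
have gi := Hg (i + 1); have gj := Hg (i + 2).
rewrite (_ : (fun t => _) = ((fun t => f t (i + 1) 0) * (fun t => g t (i + 2) 0)
  - (fun t => f t (i + 2) 0) * (fun t => g t (i + 1) 0))); last first.
  by apply/funext => t; rewrite mxE.
by apply: is_derive_eq; rewrite !mxE /GRing.scale/=; ring.
Qed.

Lemma is_derive_continuous (V : normedModType R) (f : R -> V) x df :
  is_derive x 1 f df -> {for x, continuous f}.
Proof.
by move=> [Df _]; apply/differentiable_continuous/derivable1_diffP.
Qed.

Lemma is_derive_ge0_le f (df : R -> R) (x y : R) :
  (forall t : R, is_derive t 1 f (df t)) -> x <= y ->
  (forall t : R, x <= t <= y -> 0 <= df t) -> f x <= f y.
Proof.
move=> Df xy df0.
have [|t /itvP txy fE] := @MVT_segment R f df x y xy (fun t _ => Df t).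
  by apply: continuous_subspaceT => t; apply: is_derive_continuous (Df t).
by rewrite -subr_ge0 fE mulr_ge0 ?subr_ge0// df0// !txy.
Qed.

Local Notation mu := (@lebesgue_measure R).

Definition segment_integrable (h : R -> R) :=
  forall a b, mu.-integrable `[a, b] (EFin \o h).

(* For either sign of [x], one of the two integrals is zero. *)
Definition primitive (h : R -> R) (x : R) : R :=
  \int[mu]_(t in `[0, x]) h t - \int[mu]_(t in `[x, 0]) h t.

Lemma Rintegral_itv_cat (h : R -> R) a b c : segment_integrable h ->
  a <= b -> b <= c ->
  \int[mu]_(t in `[a, c]) h t =
  \int[mu]_(t in `[a, b]) h t + \int[mu]_(t in `[b, c]) h t.
Proof.
move=> ih ab bc; apply/eqP; rewrite addrC -subr_eq; apply/eqP.
rewrite Rintegral_itvB ?bnd_simp// Rintegral_itv_obnd_cbnd//.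
by apply: integrableS (ih b c) => //; apply: subset_itv_oc_cc.
Qed.

Lemma Rintegral_itv1 (h : R -> R) a : \int[mu]_(t in `[a, a]) h t = 0.
Proof. by rewrite set_itv1 Rintegral_set1. Qed.

Lemma Rintegral_itv_lt (h : R -> R) a b : b <= a ->
  \int[mu]_(t in `[a, b]) h t = 0.
Proof.
rewrite le_eqVlt => /predU1P[->|ba]; first exact: Rintegral_itv1.
by rewrite set_itv_ge ?Rintegral_set0// bnd_simp -ltNge.
Qed.

Lemma primitive0 h : primitive h 0 = 0.
Proof. by rewrite /primitive Rintegral_itv1 subrr. Qed.

Lemma primitiveB (h : R -> R) a b : segment_integrable h -> a <= b ->
  primitive h b - primitive h a = \int[mu]_(t in `[a, b]) h t.
Proof.
move=> ih ab; rewrite /primitive.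
have [b0|b0] := leP b 0.
  have a0 := le_trans ab b0.
  rewrite (Rintegral_itv_lt _ 0 b)// (Rintegral_itv_lt _ 0 a)//.
  by rewrite (Rintegral_itv_cat _ a b 0)//; ring.
have [a0|a0] := leP a 0.
  rewrite (Rintegral_itv_lt _ 0 a)// (Rintegral_itv_lt _ b 0) ?ltW//.
  by rewrite (Rintegral_itv_cat _ a 0 b)// ?ltW//; ring.
rewrite (Rintegral_itv_lt _ b 0) ?ltW// (Rintegral_itv_lt _ a 0) ?ltW//.
by rewrite (Rintegral_itv_cat _ 0 a b)// ?ltW//; ring.
Qed.

(** Trades the two-sided formula for an integral from the fixed endpoint [x - 1], the form to which
    continuity of the parameterized integral and the fundamental theorem apply. *)
Lemma near_primitive h x : segment_integrable h ->
  \forall y \near x,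
    primitive h y = primitive h (x - 1) + \int[mu]_(t in `[x - 1, y]) h t.
Proof.
move=> ih; near=> y; rewrite -primitiveB//; first by ring.
by apply/ltW; near: y; apply: lt_nbhsr; rewrite ltrBlDr ltrDl.
Unshelve. all: by end_near. Qed.

Lemma continuous_primitive h : segment_integrable h -> continuous (primitive h).
Proof.
move=> ih x.
have H : {for x, continuous (fun y => primitive h (x - 1) +
     \int[mu]_(t in `[x - 1, y]) h t)}.
  apply: continuousD; first exact: cst_continuous.
  have /= := @parameterized_integral_continuous R (x - 1) (x + 1) h _ (ih _ _).
  rewrite /parameterized_integral => H.
  apply: (within_continuous_continuous _ (H _)); last 2 first.
  - by lra.
  - by rewrite in_itv/=; lra.
  - by lra.
have E := near_primitive _ x ih.
rewrite /prop_for/continuous_at (nbhs_singleton E).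
apply: cvg_trans H; apply: near_eq_cvg.
by near=> y; apply/esym; near: y.
Unshelve. all: by end_near. Qed.

Lemma continuous_segment_integrable h : continuous h -> segment_integrable h.
Proof.
move=> ch a b; apply: continuous_compact_integrable.
  exact: segment_compact.
exact: continuous_subspaceT.
Qed.

Lemma segment_integrable_cst c : segment_integrable (cst c).
Proof. by apply: continuous_segment_integrable => x; exact: cst_continuous. Qed.

Lemma segment_integrableB f g : segment_integrable f -> segment_integrable g ->
  segment_integrable (fun x => f x - g x).
Proof.
move=> fi gi a b.
rewrite (_ : EFin \o _ = ((EFin \o f) \- (EFin \o g))%E)//.
exact: (integrableB _ (fi _ _) (gi _ _)).
Qed.

Lemma continuous_segment_lebesgue_pt h x : segment_integrable h ->
  {for x, continuous h} -> lebesgue_pt h x.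
Proof.
move=> ih; apply: (@continuous_lebesgue_pt _ _ _ (ball x 1)).
- exact: ball_open_nbhs.
- exact: measurable_ball.
- have /integrableP[/measurable_EFinP mh _] := ih (x - 1) (x + 1).
  by apply: measurable_funS mh => //; rewrite ball_itv; exact: subset_itv_oo_cc.
Qed.

(** Needed for an [h] that is not continuous: it is applied to the coordinates of the weak
    derivative [df]. *)
Lemma is_derive_primitive_lebesgue_pt h x : segment_integrable h ->
  lebesgue_pt h x -> is_derive x 1 (primitive h) (h x).
Proof.
move=> ih hx.
have [| | | |Dh Eh] := @FTC1_lebesgue_pt R h (BLeft (x - 1)) x (x + 1).
- by lra.
- exact: ih.
- by rewrite lte_fin; lra.
- exact: hx.
apply: (@near_eq_is_derive _ _ _ (fun y => primitive h (x - 1) +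
     \int[mu]_(t in `[x - 1, y]) h t)).
- by near=> y; apply/esym; near: y; apply: near_primitive.
- have H : is_derive x 1 (fun y => \int[mu]_(t in `[x - 1, y]) h t) (h x).
    by apply: DeriveDef; [exact: Dh|rewrite -derive1E].
  by rewrite -[h x]add0r; apply: is_deriveD.
Unshelve. all: by end_near. Qed.

Lemma is_derive_primitive h x : segment_integrable h -> {for x, continuous h} ->
  is_derive x 1 (primitive h) (h x).
Proof.
move=> ih chx; apply: is_derive_primitive_lebesgue_pt => //.
exact: continuous_segment_lebesgue_pt.
Qed.

End calculus.

(** * Growth bounds deduced from bounds on derivatives *)

Section bounds.
Context {R : realType}.

Lemma continuous_bounded (g : R -> R) (N : R) : continuous g ->
  exists2 B, 0 <= B & forall t, `|t| <= N -> `|g t| <= B.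
Proof.
move=> cg; have [N0|N0] := leP 0 N; last first.
  exists 0 => // t tN; have := normr_ge0 t; lra.
have [||c _ H] := @EVT_max R (fun t => `|g t|) (- N) N.
- lra.
- apply: continuous_subspaceT => t.
  by apply: continuous_comp; [exact: cg|exact: norm_continuous].
exists `|g c| => // t tN; apply: H.
by rewrite in_itv/= -ler_norml.
Qed.

Lemma continuous_sum (T : topologicalType) (I : Type) (r : seq I)
  (F : I -> T -> R) :
  (forall i, continuous (F i)) -> continuous (fun x => \sum_(i <- r) F i x).
Proof.
move=> cF; apply: continuous_big => // x; exact: add_continuous.
Qed.

(** For [x >= 0] and a sign [s], the function [K / (j+1) u^(j+1) - s f(u)] has a nonnegative
    derivative and vanishes at 0; negative [x] follow by reflection. This is the step that produces
    the factorials in the Picard estimates. *)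
Lemma is_derive_powr_le (f df : R -> R) (K N : R) j :
  f 0 = 0 -> (forall t : R, is_derive t 1 f (df t)) ->
  (forall t, `|t| <= N -> `|df t| <= K * `|t| ^+ j) ->
  forall x, `|x| <= N -> `|f x| <= K / j.+1%:R * `|x| ^+ j.+1.
Proof.
wlog suff pos : f df / f 0 = 0 -> (forall t : R, is_derive t 1 f (df t)) ->
    (forall t, `|t| <= N -> `|df t| <= K * `|t| ^+ j) ->
    forall x, 0 <= x <= N -> `|f x| <= K / j.+1%:R * `|x| ^+ j.+1.
  move=> f0 Df dfK x xN; have [x0|x0] := leP 0 x.
    by apply: (pos f df) => //; rewrite x0/= -(ger0_norm x0).
  have := pos (fun t => f (- t)) (fun t => - df (- t)) _ _ _ (- x).
  rewrite opprK normrN; apply.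
  - by rewrite oppr0.
  - move=> t; have Dt := Df (- t).
    rewrite (_ : (fun u => _) = f \o -%R)//.
    by apply: is_derive_eq; rewrite mulrN1.
  - by move=> t tN; rewrite normrN -(normrN t) dfK ?normrN.
  - by rewrite -(ltr0_norm x0) normr_ge0.
move=> f0 Df dfK x /andP[x0 xN].
have H (s : R) : `|s| = 1 -> s * f x <= K / j.+1%:R * `|x| ^+ j.+1.
  move=> s1.
  have Dg (t : R) : is_derive t 1 (fun u => K / j.+1%:R * u ^+ j.+1 - s * f u)
      (K * t ^+ j - s * df t).
    have Dt := Df t.
    rewrite (_ : (fun u => _) = cst (K / j.+1%:R) * id ^+ j.+1 - cst s * f).
      apply: is_derive_eq; rewrite /GRing.scale/=.
      by rewrite !mulr0 !addr0 mulr1 mulrA divfK ?pnatr_eq0.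
    by apply/funext => u; rewrite !fctE.
  have := is_derive_ge0_le _ _ _ _ Dg x0.
  rewrite f0 expr0n/= !mulr0 subr0 ger0_norm// subr_ge0; apply => t /andP[t0 tx].
  rewrite subr_ge0 (le_trans (ler_norm _))// normrM s1 mul1r.
  have /dfK : `|t| <= N by rewrite ger0_norm// (le_trans tx).
  by rewrite (ger0_norm t0).
rewrite ler_norml; apply/andP; split; last first.
  by have := H 1; rewrite normr1 mul1r; apply.
by rewrite lerNl; have := H (- 1); rewrite normrN normr1 mulN1r; apply.
Qed.

Lemma is_derive_lipschitz (f df : R -> R) (L N : R) :
  (forall t : R, is_derive t 1 f (df t)) ->
  (forall t, `|t| <= N -> `|df t| <= L) ->
  forall x y, `|x| <= N -> `|y| <= N -> `|f x - f y| <= L * `|x - y|.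
Proof.
move=> Df dfL x y; wlog xy : x y / x <= y.
  move=> H xN yN; have [/H|/ltW/H] := leP x y; first exact.
  by rewrite distrC (distrC x); apply.
move=> xN yN.
have [|t /itvP txy fE] := @MVT_segment R f df x y xy (fun t _ => Df t).
  by apply: continuous_subspaceT => t; apply: is_derive_continuous (Df t).
rewrite distrC fE normrM distrC ler_wpM2r//; apply: dfL.
move: xN yN; rewrite !ler_norml => xN yN.
have t1 : x <= t by rewrite txy.
have t2 : t <= y by rewrite txy.
lra.
Qed.

End bounds.

(** * Linear differential equations *)

Section linear_ode.
Context {R : realType}.
Variables (n : nat) (A : R -> 'M[R]_n) (y0 : 'cV[R]_n).
Hypothesis cA : forall i j, continuous (fun t => A t i j).

(** The terms of the Peano-Baker series, that is, the [j]-fold iterated integrals of [A] applied to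
    [y0]. The usual Picard approximations are their partial sums [picard_sum]. *)
Fixpoint picard (j : nat) (x : R) : 'cV[R]_n :=
  if j is j'.+1 then
    \col_i primitive (fun t => (A t *m picard j' t) i 0) x
  else y0.

Definition picard_sum (J : nat) (x : R) (i : 'I_n) : R :=
  series (fun j => picard j x i 0) J.

Lemma continuous_mulmx_coord (y : R -> 'cV[R]_n) i :
  (forall k, continuous (fun t => y t k 0)) ->
  continuous (fun t => (A t *m y t) i 0).
Proof.
move=> cy; under eq_fun do rewrite mxE.
by apply: continuous_sum => k t; apply: continuousM; [apply: cA|apply: cy].
Qed.

Lemma continuous_picard j k : continuous (fun t => picard j t k 0).
Proof.
elim: j k => [|j IH] k /=; first by move=> t; apply: cst_continuous.
under eq_fun do rewrite mxE.
apply/continuous_primitive/continuous_segment_integrable.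
exact: continuous_mulmx_coord.
Qed.

Lemma is_derive_primitive_mulmx (y : R -> 'cV[R]_n) i (x : R) :
  (forall k, continuous (fun t => y t k 0)) ->
  is_derive x 1 (primitive (fun t => (A t *m y t) i 0)) ((A x *m y x) i 0).
Proof.
move=> cy; have cAy := continuous_mulmx_coord _ i cy.
apply: is_derive_primitive; [exact: continuous_segment_integrable|exact: cAy].
Qed.

Lemma is_derive_picardS j i (x : R) :
  is_derive x 1 (fun t => picard j.+1 t i 0) ((A x *m picard j x) i 0).
Proof.
rewrite /=; under eq_fun do rewrite mxE.
exact/is_derive_primitive_mulmx/continuous_picard.
Qed.

(** Differentiation kills the constant term [y0] and turns each term [j+1] into [A] times the term
    [j], which lowers the number of terms by one. *)
Lemma is_derive_picard_sum J i (x : R) :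
  is_derive x 1 (fun t => picard_sum J.+1 t i)
    ((A x *m (\col_k picard_sum J x k)) i 0).
Proof.
have -> : (fun t => picard_sum J.+1 t i) =
    cst (y0 i 0) + \sum_(j < J) (fun t => picard j.+1 t i 0).
  apply/funext => t; rewrite /picard_sum seriesEord/= big_ord_recl/=.
  by rewrite fctE fct_sumE.
have D (j : 'I_J) := is_derive_picardS j i x.
apply: is_derive_eq; rewrite add0r [RHS]mxE.
under eq_bigr do rewrite mxE.
rewrite exchange_big/=; apply: eq_bigr => k _.
by rewrite mxE /picard_sum seriesEord/= mulr_sumr.
Qed.

Section segment.
Variable N : R.
Hypothesis N0 : 0 <= N.

(** [M] bounds the sum of all [|A t i k|] over the segment, hence the operator norm of [A t] for the
    sup norm. It is fixed once as [coord_bound], so that all the later estimates share it. *)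
Lemma mulmx_coord_bound : exists2 M, 0 <= M &
  forall t, `|t| <= N -> forall (v : 'cV[R]_n) (a : R), 0 <= a ->
    (forall k, `|v k 0| <= a) -> forall i, `|(A t *m v) i 0| <= M * a.
Proof.
have [|M M0 HM] := @continuous_bounded R
    (fun t => \sum_i \sum_k `|A t i k|) N.
  apply: continuous_sum => i; apply: continuous_sum => k t.
  by apply: continuous_comp; [exact: cA|exact: norm_continuous].
exists M => // t tN v a a0 va i; rewrite mxE (le_trans (ler_norm_sum _ _ _))//.
rewrite (@le_trans _ _ (\sum_k `|A t i k| * a))//.
  by apply: ler_sum => k _; rewrite normrM ler_wpM2l.
rewrite -mulr_suml ler_wpM2r// (le_trans _ (HM t tN))//.
rewrite (le_trans _ (ler_norm _))// [leRHS](bigD1 i)//= lerDl.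
by apply: sumr_ge0 => k _; apply: sumr_ge0.
Qed.

Definition coord_bound := sval (cid2 mulmx_coord_bound).
Local Notation M := coord_bound.

Definition initial_bound := \sum_i `|y0 i 0|.
Local Notation C := initial_bound.

Lemma coord_bound_ge0 : 0 <= M.
Proof. by rewrite /M; case: cid2. Qed.

Lemma mulmx_coord_le t (v : 'cV[R]_n) (a : R) : `|t| <= N -> 0 <= a ->
    (forall k, `|v k 0| <= a) -> forall i, `|(A t *m v) i 0| <= M * a.
Proof. by rewrite /M; case: cid2 => /= M _ H tN a0 va; exact: H. Qed.

Lemma initial_bound_ge0 : 0 <= C.
Proof. by apply: sumr_ge0 => i _. Qed.

(** Each integration raises the power of [|x|] by one and divides by the new exponent, while [A]
    contributes a factor [M]; so the terms are dominated by those of [C exp (M |x|)]. *)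
Lemma picard_pow_le j x i : `|x| <= N ->
  `|picard j x i 0| <= C * M ^+ j / j`!%:R * `|x| ^+ j.
Proof.
elim: j x i => [|j IH] x i xN.
  rewrite expr0 !mulr1 divr1 /C (bigD1 i)//= lerDl.
  by apply: sumr_ge0.
have := is_derive_powr_le (fun t => picard j.+1 t i 0)
  (fun t => (A t *m picard j t) i 0) (M * (C * M ^+ j / j`!%:R)) N j.
have -> : M * (C * M ^+ j / j`!%:R) / j.+1%:R = C * M ^+ j.+1 / j.+1`!%:R.
  rewrite factS natrM exprS; field.
  by rewrite !gt_eqF// ltr0n// fact_gt0.
apply => //.
- by rewrite mxE primitive0.
- by move=> t; exact: is_derive_picardS.
- move=> t tN; rewrite -(mulrA M); apply: mulmx_coord_le => // [|k].
    by rewrite !mulr_ge0// ?initial_bound_ge0// ?exprn_ge0// ?coord_bound_ge0.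
  exact: IH.
Qed.

Lemma picard_le j x i : `|x| <= N -> `|picard j x i 0| <= C * exp_coeff (M * N) j.
Proof.
move=> xN; rewrite (le_trans (picard_pow_le j x i xN))//.
rewrite /exp_coeff/= exprMn mulrAC [leRHS]mulrA mulrA.
rewrite !ler_wpM2r// ler_wpM2l ?lerXn2r ?nnegrE//.
by rewrite mulr_ge0 ?initial_bound_ge0// exprn_ge0 ?coord_bound_ge0.
Qed.

Local Notation E := (series (exp_coeff (M * N))).

Lemma MN_ge0 : 0 <= M * N.
Proof. by rewrite mulr_ge0// coord_bound_ge0. Qed.

Lemma series_exp_coeff_le J : E J <= expR (M * N).
Proof.
apply: nondecreasing_cvgn_le; last exact: is_cvg_series_exp_coeff.
apply/nondecreasing_seqP => k; rewrite !seriesEnat/= big_nat_recr//= lerDl.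
by apply: exp_coeff_ge0; exact: MN_ge0.
Qed.

Lemma picard_sumB_le J K x i : `|x| <= N -> (J <= K)%N ->
  `|picard_sum K x i - picard_sum J x i| <= C * (E K - E J).
Proof.
move=> xN JK; rewrite /picard_sum !sub_series_geq// mulr_sumr.
by rewrite (le_trans (ler_norm_sum _ _ _))// ler_sum// => j _; exact: picard_le.
Qed.

Lemma picard_sum_le J x i : `|x| <= N -> `|picard_sum J x i| <= C * expR (M * N).
Proof.
move=> xN; have := picard_sumB_le 0 J x i xN isT.
have s0 (u : R ^nat) : series u 0 = 0 by rewrite seriesEnat/= big_geq.
rewrite {2}/picard_sum !s0 !subr0 => /le_trans; apply.
by rewrite ler_wpM2l ?initial_bound_ge0//; exact: series_exp_coeff_le.
Qed.

Lemma cvg_picard_sum x i : `|x| <= N -> cvgn (fun J => picard_sum J x i).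
Proof.
move=> xN; apply: normed_cvg.
apply: (@series_le_cvg _ _ (fun j => C * exp_coeff (M * N) j)).
- move=> j /=; exact: normr_ge0.
- move=> j /=; rewrite mulr_ge0 ?initial_bound_ge0// exp_coeff_ge0//.
  exact: MN_ge0.
- by move=> j; exact: picard_le.
- by apply: is_cvg_seriesZ; exact: is_cvg_series_exp_coeff.
Qed.

Definition picard_lim (x : R) (i : 'I_n) : R := limn (fun J => picard_sum J x i).

Lemma picard_lim_tail J x i : `|x| <= N ->
  `|picard_lim x i - picard_sum J x i| <= C * (expR (M * N) - E J).
Proof.
move=> xN.
apply: (@ler_cvg_to _ \oo _ _ (fun K => `|picard_sum K x i - picard_sum J x i|)
   (fun K => C * (E K - E J))).
- apply: cvg_norm; apply: cvgB; last exact: cvg_cst.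
  exact: cvg_picard_sum.
- apply: cvgMl_tmp; apply: cvgB; last exact: cvg_cst.
  exact: is_cvg_series_exp_coeff.
- by exists J => // K /= JK; exact: picard_sumB_le.
Qed.

(** The partial sums are bounded by [C exp (M N)], so their derivatives are bounded uniformly in
    [J]; the common Lipschitz constant survives the pointwise limit. *)
Lemma picard_lim_lipschitz x y i : `|x| <= N -> `|y| <= N ->
  `|picard_lim x i - picard_lim y i| <= M * (C * expR (M * N)) * `|x - y|.
Proof.
move=> xN yN; apply: (@cvgr_to_le _ \oo _ _
  (fun J => `|picard_sum J x i - picard_sum J y i|)).
  by apply: cvg_norm; apply: cvgB; exact: cvg_picard_sum.
(* The derivative formula concerns sums of [J+1] terms, so the empty sum is left out. *)
exists 1%N => // -[//|J] _ /=.
apply: (is_derive_lipschitz (fun t => picard_sum J.+1 t i)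
  (fun t => (A t *m \col_k picard_sum J t k) i 0) _ N) => // t.
  exact: is_derive_picard_sum.
move=> tN; apply: mulmx_coord_le => // [|k].
  by rewrite mulr_ge0 ?expR_ge0// initial_bound_ge0.
by rewrite mxE picard_sum_le.
Qed.

End segment.

Lemma continuous_picard_lim i : continuous (picard_lim ^~ i).
Proof.
(* The margin 1 makes [[-N, N]] a neighbourhood of [x]. *)
move=> x; set N := `|x| + 1; have N0 : 0 <= N by rewrite addr_ge0.
set L := coord_bound N * (initial_bound * expR (coord_bound N * N)).
have L0 : 0 <= L.
  by rewrite !mulr_ge0 ?expR_ge0 ?initial_bound_ge0 ?coord_bound_ge0.
apply/cvgrPdist_le => e e0; near=> y.
rewrite (le_trans (picard_lim_lipschitz N N0 _ _ _ _ _))//.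
- by rewrite /N lerDl.
- have : `|x - y| <= 1 by near: y; apply: cvgr_dist_le.
  by have := ler_distD x y 0; rewrite !subr0 distrC /N; lra.
- rewrite -/L (@le_trans _ _ ((L + 1) * `|x - y|))//.
    by rewrite ler_wpM2r// lerDl.
  rewrite mulrC -ler_pdivlMr ?ltr_wpDl//.
  by near: y; apply: cvgr_dist_le => //; rewrite divr_gt0 ?ltr_wpDl.
Unshelve. all: by end_near. Qed.

(** Both sides are limits of [picard_sum J.+1 x i]: the right side minus this sum has derivative
    [A (lim - S_J)], which is controlled by the tail of the exponential series. *)
Lemma picard_limE x i :
  picard_lim x i =
  y0 i 0 + primitive (fun t => (A t *m \col_k picard_lim t k) i 0) x.
Proof.
have cL k : continuous (fun t => (\col_k picard_lim t k) k 0).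
  by under eq_fun do rewrite mxE; exact: continuous_picard_lim.
set P := primitive _ x.
have N0 := normr_ge0 x; set N := `|x| in N0.
have cvgL : picard_sum J.+1 x i @[J --> \oo] --> picard_lim x i.
  by have := cvg_picard_sum N N0 x i (lexx _); rewrite -cvg_shiftS.
apply: (cvg_unique _ cvgL) => //.
set E := series (exp_coeff (coord_bound N * N)).
set c := coord_bound N * initial_bound * N.
apply/cvgrPdist_le.
suff H : c * (expR (coord_bound N * N) - E J) @[J --> \oo] --> 0.
  move=> e e0; near=> J.
  have : `|0 - c * (expR (coord_bound N * N) - E J)| <= e.
    by near: J; exact: cvgr_dist_le.
  rewrite sub0r normrN => /(le_trans (ler_norm _)); apply: le_trans.
  have D (t : R) : is_derive t 1
      ((cst (y0 i 0) + primitive (fun t => (A t *m \col_k picard_lim t k) i 0))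
       - (fun t => picard_sum J.+1 t i))
      ((A t *m (\col_k picard_lim t k)) i 0
        - (A t *m (\col_k picard_sum J t k)) i 0).
    have D1 := is_derive_primitive_mulmx _ i t cL.
    have D2 := is_derive_picard_sum J i t.
    by apply: is_derive_eq; rewrite add0r.
  (* With exponent 0 this is the mean value bound [|F x| <= K |x|]; the factor [|x| = N] accounts
     for the [N] in [c]. *)
  have := is_derive_powr_le _ _
    (coord_bound N * (initial_bound * (expR (coord_bound N * N) - E J))) N 0 _ D.
  rewrite !fctE divr1 => /(_ _ _ x (lexx _)); rewrite expr1 -/N.
  rewrite !mulrA [X in _ -> _ -> _ <= X]mulrAC; apply.
    rewrite primitive0 addr0 /picard_sum seriesEord/= big_ord_recl/= big1 ?addr0 ?subrr//.
    by move=> j _; rewrite /= mxE primitive0.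
  move=> t tN; rewrite expr0 mulr1.
  have -> u v : (A t *m u) i 0 - (A t *m v) i 0 = (A t *m (u - v)) i 0.
    by rewrite mulmxBr !mxE.
  rewrite -mulrA; apply: mulmx_coord_le => // [|k].
    by rewrite mulr_ge0 ?initial_bound_ge0// subr_ge0 series_exp_coeff_le.
  by rewrite !mxE; exact: picard_lim_tail.
have -> : (0 : R) = c * (expR (coord_bound N * N) - expR (coord_bound N * N)).
  by rewrite subrr mulr0.
apply: cvgMl_tmp; apply: cvgB; first exact: cvg_cst.
exact: is_cvg_series_exp_coeff.
Unshelve. all: by end_near. Qed.

Theorem linear_ode_exists : exists y : R -> 'cV[R]_n,
  y 0 = y0 /\ forall x : R, is_derive x 1 y (A x *m y x).
Proof.
have cL k : continuous (fun t => (\col_k picard_lim t k) k 0).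
  by under eq_fun do rewrite mxE; exact: continuous_picard_lim.
exists (fun t => \col_k picard_lim t k); split.
  by apply/colP => i; rewrite mxE picard_limE primitive0 addr0.
move=> x; apply/is_derive_mxP => i.
rewrite (_ : (fun t => _) = cst (y0 i 0) +
    primitive (fun t => (A t *m \col_k picard_lim t k) i 0)); last first.
  by apply/funext => t; rewrite mxE picard_limE.
have D := is_derive_primitive_mulmx _ i x cL.
by apply: is_derive_eq; rewrite add0r.
Qed.

End linear_ode.

(** * Smooth functions and smooth steps *)

Section smoothness.
Context {R : realType}.

(** Peels derivatives from the inside, which suits inductions that generalize over [f]. It asks for
    [k] derivatives without continuity of the last one; continuity of a function or derivative is
    obtained from one order more. *)
Fixpoint Ck {V : normedModType R} (k : nat) (f : R -> V) : Prop :=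
  if k is k'.+1 then (forall x, derivable f x 1) /\ Ck k' (derive1 f) else True.

Lemma smoothP (V : normedModType R) (f : R -> V) :
  smooth f <-> forall k, Ck k f.
Proof.
split=> [sf k|Cf k x].
  elim: k f sf => [//|k IH] f sf; split; first exact: sf 0%N.
  by apply: IH => n x; rewrite -derive1Sn; exact: sf.
elim: k f Cf x => [|k IH] f Cf x; first by have [] := Cf 1%N.
by rewrite derive1Sn; apply: IH => n; have [] := Cf n.+1.
Qed.

Lemma derive1_eqP (V : normedModType R) (f g : R -> V) :
  (forall x : R, is_derive x 1 f (g x)) -> derive1 f = g.
Proof. by move=> D; apply/funext => x; rewrite derive1E; case: (D x). Qed.

Lemma CkSP (V : normedModType R) (f g : R -> V) k :
  (forall x : R, is_derive x 1 f (g x)) -> Ck k g -> Ck k.+1 f.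
Proof. by move=> D Cg; split=> [x|]; [case: (D x)|rewrite (derive1_eqP _ _ _ D)]. Qed.

Lemma CkS_is_derive (V : normedModType R) (f : R -> V) k :
  Ck k.+1 f -> forall x : R, is_derive x 1 f (derive1 f x).
Proof. by move=> [D _] x; rewrite derive1E; apply: derivableP. Qed.

Lemma CkW (V : normedModType R) (f : R -> V) k : Ck k.+1 f -> Ck k f.
Proof.
by elim: k f => [//|k IH] f [Df Cf]; split => //; exact: IH.
Qed.

Lemma Ck_cst (V : normedModType R) (v : V) k : Ck k (cst v).
Proof.
elim: k v => [//|k IH] v; apply: (CkSP _ _ (cst 0)) => // x.
Qed.

Lemma Ck_id k : Ck k (@id R).
Proof.
case: k => [//|k]; apply: (CkSP _ id (cst (1 : R))); exact: Ck_cst.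
Qed.

Lemma CkD (V : normedModType R) (f g : R -> V) k :
  Ck k f -> Ck k g -> Ck k (f + g).
Proof.
elim: k f g => [//|k IH] f g Cf Cg.
have [_ Cf'] := Cf; have [_ Cg'] := Cg.
apply: (CkSP _ _ (derive1 f + derive1 g) _ _ (IH _ _ Cf' Cg')) => x.
apply: is_deriveD; exact: (CkS_is_derive _ _ k).
Qed.

Lemma CkM (f g : R -> R) k : Ck k f -> Ck k g -> Ck k (f * g).
Proof.
elim: k f g => [//|k IH] f g Cf Cg.
apply: (CkSP _ _ (f * derive1 g + g * derive1 f)); last first.
  have [_ Cf'] := Cf; have [_ Cg'] := Cg.
  have [Cf0 Cg0] := (CkW _ _ _ Cf, CkW _ _ _ Cg).
  by apply: CkD; apply: IH.
move=> x.
have Df := CkS_is_derive _ _ _ Cf x; have Dg := CkS_is_derive _ _ _ Cg x.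
exact: is_deriveM.
Qed.

Lemma CkN (f : R -> R) k : Ck k f -> Ck k (- f).
Proof.
move=> Cf; rewrite (_ : - f = cst (- 1) * f); first exact/CkM/Cf/Ck_cst.
by apply/funext => x; rewrite !fctE mulN1r.
Qed.

Lemma Ck_affine (f : R -> R) (a b : R) k :
  Ck k f -> Ck k (fun x => f (a * x + b)).
Proof.
elim: k f => [//|k IH] f Cf.
apply: (CkSP _ _ (cst a * (fun x => derive1 f (a * x + b)))); last first.
  by apply: CkM; [exact: Ck_cst|apply: IH; case: Cf].
move=> x; have Df := CkS_is_derive _ _ _ Cf (a * x + b).
rewrite (_ : (fun x => _) = f \o (cst a * id + cst b))//.
apply: is_derive_eq.
by rewrite !fctE /GRing.scale/=; ring.
Qed.

Lemma CkV (f : R -> R) k : (forall x, f x != 0) ->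
  Ck k f -> Ck k (fun x => (f x)^-1).
Proof.
move=> f0; elim: k => [//|k IH] Cf.
have Cf' : Ck k f by exact: CkW.
apply: (CkSP R (fun x => (f x)^-1)
  (- (derive1 f * ((fun x => (f x)^-1) * (fun x => (f x)^-1))))).
  move=> x; have Df := CkS_is_derive _ _ _ Cf x.
  apply: is_derive_eq.
  by rewrite /GRing.scale/= !fctE -invfM expr2 mulrC mulrN.
apply/CkN/CkM; first by case: Cf.
by apply: CkM; apply: IH.
Qed.

Lemma Ck_col n (f : R -> 'cV[R]_n) k :
  (forall i, Ck k (fun x => f x i 0)) -> Ck k f.
Proof.
elim: k f => [//|k IH] f Cf.
apply: (CkSP _ _ (fun x => \col_i (fun t => f t i 0)^`() x)).
  move=> x; apply/is_derive_mxP => i; rewrite mxE.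
  exact: (CkS_is_derive _ _ _ (Cf i)).
apply: IH => i; under eq_fun do rewrite mxE.
by case: (Cf i).
Qed.

(* The linear span of these functions is closed under differentiation, so that
   smoothness reduces to differentiability at 0. *)
Definition exp_flat (n : nat) (x : R) : R :=
  if 0 < x then x ^- n * expR (- x^-1) else 0.

Lemma exp_flat_ge0 n x : 0 <= exp_flat n x.
Proof.
rewrite /exp_flat; case: ifPn => // x0.
by rewrite mulr_ge0 ?expR_ge0// invr_ge0 exprn_ge0// ltW.
Qed.

(** From [exp y >= y^(n+2) / (n+2)!] at [y = 1/x]. The order [n+2] leaves a factor [x^2], enough for
    the difference quotient at 0 to vanish. *)
Lemma exp_flat_le n x : exp_flat n x <= n.+2`!%:R * x ^+ 2.
Proof.
rewrite /exp_flat; case: ifPn => [x0|_]; last by rewrite mulr_ge0// sqr_ge0.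
have y0 : 0 < x^-1 by rewrite invr_gt0.
have := expR_ge1Dxn n.+1 (ltW y0); set y := x^-1 => H.
have F0 : 0 < n.+2`!%:R :> R by rewrite ltr0n fact_gt0.
have {}H : y ^+ n.+2 <= n.+2`!%:R * expR y.
  by rewrite mulrC -ler_pdivrMr// (le_trans _ H)// lerDr.
rewrite -exprVn -/y; have -> : x ^+ 2 = (y ^+ 2)^-1 by rewrite /y exprVn invrK.
rewrite expRN ler_pdivrMr ?expR_gt0// mulrAC.
by rewrite ler_pdivlMr ?exprn_gt0// -exprD addn2.
Qed.

Lemma is_derive_exp_flat n (x : R) :
  is_derive x 1 (exp_flat n) (exp_flat n.+2 x - n%:R * exp_flat n.+1 x).
Proof.
have [x0|x0|->] := ltrgtP x 0.
- apply: (@near_eq_is_derive _ _ _ (cst 0)).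
    near=> y; rewrite /exp_flat ifF//; apply/negbTE; rewrite -leNgt ltW//.
    by near: y; exact: lt_nbhsl.
  by rewrite /exp_flat ltNge ltW//= mulr0 subr0; exact: is_derive_cst.
- apply: (@near_eq_is_derive _ _ _
     (fun y : R => (y^-1) ^+ n * expR (- y^-1))).
    near=> y; rewrite /exp_flat ifT ?exprVn//.
    by near: y; exact: lt_nbhsr.
  have Dinv : is_derive x 1 (fun y : R => y^-1) (- x ^- 2 *: 1).
    by apply: (@is_deriveV R id); rewrite gt_eqF.
  rewrite (_ : (fun y => _) = (fun y => y^-1) ^+ n
    * (expR \o (- (fun y => y^-1)))); last by apply/funext => y; rewrite !fctE.
  apply: is_derive_eq; rewrite !fctE /GRing.scale/= /exp_flat x0.
  rewrite -!exprVn; case: n => [|n]; first by rewrite expr0 !mul0r subr0; ring.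
  by rewrite /= !exprS; ring.
- rewrite /exp_flat ltxx mulr0 subr0 -/(exp_flat n).
  have H : h^-1 *: (exp_flat n (h *: 1 + 0) - exp_flat n 0) @[h --> 0^'] --> (0 : R).
    have F0 : 0 < n.+2`!%:R :> R by rewrite ltr0n fact_gt0.
    apply/cvgrPdist_le => e e0; near=> h.
    have h0 : h != 0 by near: h; exact: nbhs_dnbhs_neq.
    have -> : exp_flat n 0 = 0 by rewrite /exp_flat ltxx.
    rewrite sub0r normrN subr0 addr0 /GRing.scale/= mulr1 normrM normfV.
    rewrite mulrC ler_pdivrMr ?normr_gt0// ger0_norm ?exp_flat_ge0//.
    rewrite (le_trans (exp_flat_le _ _))// -real_normK ?num_real// expr2.
    rewrite mulrA ler_wpM2r// mulrC -ler_pdivlMr//.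
    by near: h; apply: dnbhs0_le; rewrite divr_gt0.
  apply: DeriveDef; first by apply/cvg_ex; exists 0.
  exact: cvg_lim H.
Unshelve. all: by end_near. Qed.

Lemma Ck_exp_flat n k : Ck k (exp_flat n).
Proof.
elim: k n => [//|k IH] n; apply: CkSP (is_derive_exp_flat n) _.
apply: CkD => //.
by apply/CkN/(CkM (cst _)) => //; exact: Ck_cst.
Qed.

(** The classical quotient [h(x) / (h(x) + h(1 - x))] with [h(x) = exp (-1/x)] for [x > 0], going
    from 0 on the left of 0 to 1 on the right of 1. The argument [1 - x] is spelled as in
    [Ck_affine]. *)
Definition smooth_step (x : R) : R :=
  exp_flat 0 x * (exp_flat 0 x + exp_flat 0 (-1 * x + 1))^-1.

Lemma exp_flat_gt0 n x : 0 < x -> 0 < exp_flat n x.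
Proof.
by move=> x0; rewrite /exp_flat x0 mulr_gt0 ?expR_gt0// invr_gt0 exprn_gt0.
Qed.

Lemma smooth_step_denom_gt0 x : 0 < exp_flat 0 x + exp_flat 0 (-1 * x + 1).
Proof.
have [x0|x0] := ltP 0 x.
  by rewrite ltr_pwDl ?exp_flat_gt0 ?exp_flat_ge0.
by rewrite ltr_wpDl ?exp_flat_ge0// exp_flat_gt0//; lra.
Qed.

Lemma Ck_smooth_step k : Ck k smooth_step.
Proof.
apply: (CkM (exp_flat 0)); first exact: Ck_exp_flat.
apply: (CkV (exp_flat 0 + fun x => exp_flat 0 (-1 * x + 1))).
  by move=> x; rewrite gt_eqF// smooth_step_denom_gt0.
apply: CkD; first exact: Ck_exp_flat.
exact/Ck_affine/Ck_exp_flat.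
Qed.

Lemma smooth_step_le0 x : x <= 0 -> smooth_step x = 0.
Proof. by move=> x0; rewrite /smooth_step {1}/exp_flat ltNge x0 mul0r. Qed.

Lemma smooth_step_ge1 x : 1 <= x -> smooth_step x = 1.
Proof.
move=> x1; rewrite /smooth_step [X in _ + X]/exp_flat ifF ?addr0 ?divff//.
  by rewrite gt_eqF// exp_flat_gt0//; lra.
by apply/negbTE; lra.
Qed.

Lemma smooth_step_ge0 x : 0 <= smooth_step x.
Proof. by rewrite mulr_ge0 ?exp_flat_ge0// invr_ge0 ltW// smooth_step_denom_gt0. Qed.

Lemma smooth_step_le1 x : smooth_step x <= 1.
Proof.
by rewrite ler_pdivrMr ?smooth_step_denom_gt0// mul1r lerDl exp_flat_ge0.
Qed.

Lemma smooth_step_derive_cst (x : R) : x < 0 \/ 1 < x -> derive1 smooth_step x = 0.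
Proof.
rewrite derive1E; case=> x0.
- rewrite (@near_eq_derive _ _ _ _ (cst 0)) ?derive_cst//.
  near=> y; apply: smooth_step_le0; apply/ltW; near: y; exact: lt_nbhsl.
- rewrite (@near_eq_derive _ _ _ _ (cst (1 : R))) ?derive_cst//.
  near=> y; apply: smooth_step_ge1; apply/ltW; near: y; exact: lt_nbhsr.
Unshelve. all: by end_near. Qed.

Lemma smooth_step_derive_bound :
  exists2 B, 0 <= B & forall x, `|derive1 smooth_step x| <= B.
Proof.
have [|B B0 HB] := @continuous_bounded R (derive1 smooth_step) 1.
  move=> x; have [_ C] := Ck_smooth_step 2.
  apply: is_derive_continuous; exact: (CkS_is_derive _ _ 0 C x).
exists B => // x; have [|x1] := leP `|x| 1; first exact: HB.
rewrite smooth_step_derive_cst ?normr0//.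
by move: x1; rewrite ltNge ler_norml negb_and -!ltNge => /orP[|]; [left|right]; lra.
Qed.

End smoothness.

(** * Integration on segments and rescaled smooth steps *)

Section smooth_steps.
Context {R : realType}.
Local Notation mu := (@lebesgue_measure R).

Lemma locally_integrable_segment (h : R -> R) :
  locally_integrable setT h -> segment_integrable h.
Proof.
move=> [mh _ ih] a b; apply/integrableP; split.
  by apply/measurable_EFinP; apply: measurable_funS mh.
by apply: ih => //; exact: segment_compact.
Qed.

Lemma segment_integrableM (g phi : R -> R) a b B : segment_integrable g ->
  measurable_fun setT phi -> (forall x, `|phi x| <= B) ->
  mu.-integrable `[a, b] (EFin \o (fun x => g x * phi x)).
Proof.
move=> ig mphi phiB.
have mg : measurable_fun `[a, b] g.
  by have /integrableP[/measurable_EFinP] := ig a b.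
have ig' : mu.-integrable `[a, b] (EFin \o (fun x => B * g x)).
  exact: (integrableZl _ B (ig a b)).
apply: le_integrable ig' => //.
  apply/measurable_EFinP; apply: measurable_funM => //.
  exact: measurable_funS mphi.
move=> x _ /=; rewrite lee_fin !normrM mulrC ler_wpM2r//.
by rewrite (le_trans (phiB x)) // ler_norm.
Qed.

Lemma Rintegral_is_derive (F f : R -> R) a b : a <= b ->
  (forall x : R, is_derive x 1 F (f x)) -> continuous f ->
  \int[mu]_(x in `[a, b]) f x = F b - F a.
Proof.
move=> ab DF cf; have is_f := continuous_segment_integrable _ cf.
rewrite -primitiveB//.
have D (x : R) : is_derive x 1 (F - primitive f) 0.
  have Dp := is_derive_primitive _ _ is_f (cf x).
  by apply: is_derive_eq; rewrite subrr.
by have := is_derive_0_is_cst a b D; rewrite !fctE; lra.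
Qed.

Lemma Rintegral_support (D : set R) (F : R -> R) :
  (forall x, ~ D x -> F x = 0) -> \int[mu]_x F x = \int[mu]_(x in D) F x.
Proof.
move=> F0; rewrite [RHS]Rintegral_mkcond; congr (Rintegral _ _ _).
apply/funext => x; rewrite patchE; case: ifPn => // /negP xD.
by apply: F0; apply: contra_not xD => ?; rewrite inE.
Qed.

(** The mean of [|g - g a|] over the ball of radius [r] is eventually at most [e / 2], and this ball
    has length [2 r]. *)
Lemma lebesgue_pt_segment (g : R -> R) a e : segment_integrable g -> lebesgue_pt g a ->
  0 < e ->
  \forall r \near 0^'+, \int[mu]_(x in `[a - r, a + r]) `|g x - g a| <= e * r.
Proof.
move=> ig ga e0.
have ig' r : mu.-integrable `[a - r, a + r] (EFin \o (fun x => `|g x - g a|)).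
  exact: (integrable_norm (segment_integrableB _ _ ig
    (segment_integrable_cst (g a)) _ _)).
near=> r.
have r0 : 0 < r by [].
have : (davg g a r <= (e / 2)%:E)%E.
  near: r; move/fine_cvgP : ga => [fin cvg0].
  have /cvgrPdist_le/(_ (e / 2)) H := cvg0.
  have {}H := H (divr_gt0 e0 (ltr0n _ 2)).
  near=> r.
  have fr : davg g a r \is a fin_num by near: r.
  rewrite -(fineK fr) lee_fin.
  have : `|0 - fine (davg g a r)| <= e / 2 by near: r.
  by rewrite sub0r normrN; apply: le_trans; exact: ler_norm.
rewrite /davg /iavg lebesgue_measure_ball; last exact: ltW.
rewrite inver ifF; last first.
  by apply/negbTE; rewrite gt_eqF// mulrn_wgt0.
rewrite ball_itv -(integral_itv_bndoo true false); last first.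
  apply: measurableT_comp => //.
  apply/measurable_EFinP; apply: measurable_funB => //.
  have /integrableP[/measurable_EFinP mg _] := ig (a - r) (a + r).
  by apply: measurable_funS mg => //; exact: subset_itv_oo_cc.
have I := @integrable_fin_num _ _ _ _ _ _ _ (ig' r).
rewrite -[X in (_ * X)%E](fineK (I _)) // -EFinM lee_fin => H.
rewrite (le_trans (y := r *+ 2 * (e / 2)))//; last by rewrite -mulr_natr; lra.
by rewrite -ler_pdivrMl// mulrn_wgt0.
Unshelve. all: by end_near. Qed.

(** Rises from 0 at [a] to 1 at [a + 1/(n+1)]: the steps tend to the indicator of []a, +oo[], and
    their derivatives are one-sided mollifiers at [a]. The argument is again affine in the form of
    [Ck_affine]. *)
Definition step_at (a : R) (n : nat) (x : R) : R :=
  smooth_step (n.+1%:R * x + - (n.+1%:R * a)).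

Lemma Ck_step_at a n k : Ck k (step_at a n).
Proof. exact/Ck_affine/Ck_smooth_step. Qed.

Lemma natS_gt0 n : 0 < n.+1%:R :> R. Proof. by rewrite ltr0n. Qed.

Lemma step_at_le a n x : x <= a -> step_at a n x = 0.
Proof.
by move=> xa; apply: smooth_step_le0; rewrite subr_le0 ler_wpM2l// ltW// natS_gt0.
Qed.

Lemma step_at_ge a n x : a + n.+1%:R^-1 <= x -> step_at a n x = 1.
Proof.
move=> xa; apply: smooth_step_ge1.
by rewrite -mulrBr mulrC -ler_pdivrMr ?natS_gt0// div1r lerBrDl.
Qed.

Lemma step_at_bound a n x : `|step_at a n x| <= 1.
Proof. by rewrite ger0_norm ?smooth_step_ge0// smooth_step_le1. Qed.

Lemma is_derive_step_at a n (x : R) :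
  is_derive x 1 (step_at a n) (derive1 (step_at a n) x).
Proof. exact: (CkS_is_derive _ _ 0 (Ck_step_at a n 1)). Qed.

Lemma continuous_derive_step_at a n : continuous (derive1 (step_at a n)).
Proof.
move=> x; have [_ C] := Ck_step_at a n 2.
apply: is_derive_continuous; exact: (CkS_is_derive _ _ 0 C).
Qed.

Lemma derive_step_atE a n x : derive1 (step_at a n) x =
  n.+1%:R * derive1 (smooth_step) (n.+1%:R * x + - (n.+1%:R * a)).
Proof.
have D := CkS_is_derive _ _ 0 (Ck_smooth_step 1) (n.+1%:R * x + - (n.+1%:R * a)).
rewrite derive1E /step_at.
rewrite (_ : (fun x => _) = smooth_step \o (cst n.+1%:R * id + cst (- (n.+1%:R * a))))//.
rewrite derive_val !fctE /GRing.scale/=; ring.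
Qed.

Lemma derive_step_at_out a n x : ~ `[a, a + n.+1%:R^-1] x ->
  derive1 (step_at a n) x = 0.
Proof.
rewrite /= in_itv/= => /negP; rewrite negb_and -!ltNge => H.
rewrite derive_step_atE smooth_step_derive_cst ?mulr0//.
case/orP: H => H; [left|right].
  by rewrite subr_lt0 ltr_pM2l ?natS_gt0.
by rewrite -mulrBr mulrC -ltr_pdivrMr ?natS_gt0// div1r ltrBrDl.
Qed.

Lemma cvg_step_at a x : step_at a n x @[n --> \oo] --> ((a < x)%R%:R : R).
Proof.
have [xa|ax] := leP x a.
  rewrite (_ : (fun n => _) = cst 0); first exact: cvg_cst.
  by apply/funext => n; rewrite step_at_le.
rewrite (_ : true%:R = 1 :> R)//.
apply/cvgrPdist_le => e e0; near=> n.
rewrite step_at_ge; first by rewrite subrr normr0 ltW.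
rewrite -lerBrDl -[leRHS]invrK.
rewrite lef_pV2 ?posrE ?invr_gt0 ?subr_gt0 ?natS_gt0//.
rewrite -natr1 (@le_trans _ _ n%:R) ?lerDl//.
by near: n; exact: nbhs_infty_ger.
Unshelve. all: by end_near. Qed.

(** Neither step has compact support, but left of [a] both are 0 and right of [b + 1/(n+1)] both are
    1, so they cancel. *)
Lemma test_function_step a b n : a <= b ->
  test_function (step_at a n - step_at b n).
Proof.
move=> ab; split.
  apply/smoothP => k; apply: CkD; first exact: Ck_step_at.
  exact/CkN/Ck_step_at.
apply: (@subclosed_compact _ _ `[a, b + n.+1%:R^-1]).
- exact: closed_closure.
- exact: segment_compact.
- have -> : `[a, b + n.+1%:R^-1] = closure `[a, b + n.+1%:R^-1].
    by apply/closure_id; exact: itv_closed.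
  apply: closure_subset => x /=; rewrite !fctE in_itv/= => H.
  apply/andP; split; rewrite leNgt; apply: contra_neqN H => H.
    by rewrite !step_at_le ?subrr//; [exact: le_trans (ltW H) _|exact: ltW].
  by rewrite !step_at_ge ?subrr// ltW// (le_lt_trans _ H)// lerD2r.
Qed.

End smooth_steps.

(** * The du Bois-Reymond lemma *)

Section du_bois_reymond.
Context {R : realType}.
Local Notation mu := (@lebesgue_measure R).

Lemma derive_step_at_bound : exists2 B, 0 <= B &
  forall (a : R) n x, `|derive1 (step_at a n) x| <= B * n.+1%:R.
Proof.
have [B B0 HB] := smooth_step_derive_bound (R := R); exists B => // a n x.
rewrite derive_step_atE normrM (ger0_norm (ler0n _ _)) [leRHS]mulrC.
by apply: ler_wpM2l; rewrite ?ler0n.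
Qed.

Lemma integrable_mul_derive_step_at (g : R -> R) a n c d : segment_integrable g ->
  mu.-integrable `[c, d] (EFin \o (fun x => g x * derive1 (step_at a n) x)).
Proof.
move=> ig; have [B B0 HB] := derive_step_at_bound.
apply: (segment_integrableM g _ c d (B * n.+1%:R)) => //.
apply: continuous_measurable_fun; exact: continuous_derive_step_at.
Qed.

(* The kernel is supported in [a, a + 1/(n+1)], has integral 1 and is bounded by
   B (n+1), so that a Lebesgue point of g is enough. *)
Lemma cvg_integral_derive_step_at (g : R -> R) a : segment_integrable g ->
  lebesgue_pt g a ->
  \int[mu]_x (g x * derive1 (step_at a n) x) @[n --> \oo] --> g a.
Proof.
move=> ig ga; have [B B0 HB] := derive_step_at_bound.
apply/cvgrPdist_le => e e0.
(* The kernel bound contributes the factor [B (n+1)], and [(n+1) r = 1], so the final error is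
   [e B / (B + 1)]. Dividing by [B + 1] also covers [B = 0]. *)
have e'0 : 0 < e / (B + 1) by rewrite divr_gt0// ltr_wpDl.
have /= := lebesgue_pt_segment _ _ _ ig ga e'0.
rewrite near_withinE => -[d /= d0 Hd].
near=> n.
set r := n.+1%:R^-1 : R; have r0 : 0 < r by rewrite invr_gt0 natS_gt0.
have {Hd} : \int[mu]_(x in `[a - r, a + r]) `|g x - g a| <= e / (B + 1) * r.
  apply: Hd => //=; rewrite sub0r normrN gtr0_norm//.
  by rewrite /r; near: n; exact: (near_infty_natSinv_lt (PosNum d0)).
have supp (h : R -> R) x : ~ `[a - r, a + r] x -> h x * derive1 (step_at a n) x = 0.
  move=> H; rewrite derive_step_at_out ?mulr0//; apply: contra_not H.
  by rewrite /= !in_itv/= -/r => /andP[ax ->]; rewrite andbT; lra.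
rewrite (Rintegral_support `[a - r, a + r]) => [|x]; last exact: (supp g).
have K1 : \int[mu]_(x in `[a - r, a + r]) derive1 (step_at a n) x = 1.
  have arr : a - r <= a + r by lra.
  rewrite (Rintegral_is_derive _ _ _ _ arr (is_derive_step_at a n)
    (continuous_derive_step_at a n)).
  by rewrite step_at_ge// step_at_le ?subr0//; lra.
have ik := integrable_mul_derive_step_at _ a n (a - r) (a + r) ig.
have i1 := integrable_mul_derive_step_at (cst (g a)) a n (a - r) (a + r).
have {}i1 := i1 (segment_integrable_cst _).
move=> Hr; rewrite -[X in X - _](mulr1 (g a)) -K1 -RintegralZl//; last first.
  apply: continuous_segment_integrable; exact: continuous_derive_step_at.
rewrite distrC -RintegralB//.
have gB : segment_integrable (fun x => g x - g a).
  exact/segment_integrableB/segment_integrable_cst.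
have iB := integrable_mul_derive_step_at _ a n (a - r) (a + r) gB.
under eq_Rintegral do rewrite -mulrBl.
rewrite (le_trans (le_normr_Rintegral _ iB))//.
rewrite (@le_trans _ _ (\int[mu]_(x in `[a - r, a + r]) (B * n.+1%:R * `|g x - g a|)))//.
  apply: le_Rintegral => //.
  - exact: (integrable_norm iB).
  - exact: (integrableZl _ (B * n.+1%:R) (integrable_norm (gB _ _))).
  - by move=> x _; rewrite normrM mulrC ler_wpM2r.
rewrite RintegralZl//; last exact: (integrable_norm (gB _ _)).
have Bn0 : 0 <= B * n.+1%:R by rewrite mulr_ge0.
rewrite (le_trans (ler_wpM2l Bn0 Hr))//.
have -> : B * n.+1%:R * (e / (B + 1) * r) = e * (B / (B + 1)).
  transitivity (e * (B / (B + 1)) * (n.+1%:R * r)); first by ring.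
  by rewrite /r divff ?pnatr_eq0// mulr1.
apply: ler_piMr; first exact: ltW.
by rewrite ler_pdivrMr; lra.
Unshelve. all: by end_near. Qed.

Lemma cvg_integral_step_at (h : R -> R) a b : segment_integrable h -> a <= b ->
  \int[mu]_x (h x * (step_at a n - step_at b n) x) @[n --> \oo] -->
  \int[mu]_(x in `[a, b]) h x.
Proof.
move=> ih ab.
(* One segment containing the supports for all [n], since [1/(n+1) <= 1]; dominated convergence
   takes place on it, with bound [2 |h|]. *)
pose D : set R := `[a, b + 1].
have -> : (fun n => \int[mu]_x (h x * (step_at a n - step_at b n) x)) =
    (fun n => \int[mu]_(x in D) (h x * (step_at a n - step_at b n) x)).
  apply/funext => n; apply: Rintegral_support => x; rewrite /D/= in_itv/= !fctE.
  move=> /negP; rewrite negb_and -!ltNge => /orP[xa|bx].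
    by rewrite !step_at_le ?subrr ?mulr0// ltW// (lt_le_trans xa).
  have n1 : n.+1%:R^-1 <= 1 :> R by rewrite invf_le1 ?ler1n ?natS_gt0.
  have xb c : c <= b -> c + n.+1%:R^-1 <= x.
    by move=> cb; rewrite (le_trans _ (ltW bx))// lerD.
  by rewrite !step_at_ge ?subrr ?mulr0// xb.
have mh : measurable_fun D h.
  by have /integrableP[/measurable_EFinP] := ih a (b + 1).
have mphi n : measurable_fun setT (step_at a n - step_at b n).
  by apply: measurable_funB; apply: continuous_measurable_fun => x;
    apply: is_derive_continuous; exact: is_derive_step_at.
have phi2 n x : `|(step_at a n - step_at b n) x| <= 2.
  rewrite !fctE (le_trans (ler_normB _ _))//.
  by have := step_at_bound a n x; have := step_at_bound b n x; lra.
have iphi n := segment_integrableM _ _ a (b + 1) 2 ih (mphi n) (phi2 n).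
(* The pointwise limit is the indicator of []a, b]], so the endpoint [a] has to be dropped from the
   closed segment. *)
have EI : (\int[mu]_(x in `[a, b]) (h x)%:E =
    \int[mu]_(x in D) (h x * ((a < x)%R%:R - (b < x)%R%:R))%:E)%E.
  rewrite -integral_itv_obnd_cbnd; last first.
    apply/measurable_EFinP; apply: measurable_funS mh; first exact: measurable_itv.
    by move=> x /=; rewrite /D/= !in_itv/= => /andP[? ?]; lra.
  have sub : `]a, b] `<=` D.
    move=> x /=; rewrite /D/= !in_itv/= => /andP[ax xb].
    by rewrite (ltW ax)/= (le_trans xb)// lerDl.
  rewrite -{1}(setIidr sub) integral_mkcondr.
  apply: eq_integral => x; rewrite inE /D /= in_itv/= patchE => /andP[ax xb].
  have -> : (x \in `]a, b]) = (a < x <= b).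
    by apply/idP/idP; rewrite inE/= in_itv.
  case: (ltP a x) => xa; case: (ltP b x) => bx /=;
    rewrite ?subrr ?subr0 ?mulr0 ?mulr1//.
  by have := lt_le_trans (le_lt_trans ab bx) xa; rewrite ltxx.
rewrite /Rintegral; apply: fine_cvg; rewrite fineK; last first.
  by apply: integrable_fin_num => //; exact: ih.
rewrite EI.
apply: (@dominated_cvg _ (measurableTypeR R) R mu D (measurable_itv _)
  (fun n x => (h x * (step_at a n - step_at b n) x)%:E) _
  (fun x => (2 * `|h x|)%:E)) => //.
- by move=> n; have /integrableP[] := iphi n.
- move=> x Dx; apply: cvg_EFin; first exact: nearW.
  apply: cvgMl_tmp; apply: cvgB; exact: cvg_step_at.
- exact: (integrableZl _ 2 (integrable_norm (ih a (b + 1)))).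
- by move=> n x Dx; rewrite lee_fin normrM mulrC ler_wpM2r.
Qed.

(** Tested against [step_at a n - step_at b n], the left side tends to [g a - g b], as the
    derivative is a difference of kernels concentrating at [a] and [b]; the right side tends to
    minus the integral of [h] over the segment. Restricting to Lebesgue points gives an identity for
    [g] itself, with no change of representative. *)
Theorem du_bois_reymond (g h : R -> R) a b :
  segment_integrable g -> segment_integrable h ->
  (forall phi : R -> R, test_function phi ->
    \int[mu]_x (g x * derive1 phi x) = - \int[mu]_x (h x * phi x)) ->
  a <= b -> lebesgue_pt g a -> lebesgue_pt g b ->
  g b - g a = \int[mu]_(x in `[a, b]) h x.
Proof.
move=> ig ih gh ab ga gb.
have Ca := cvg_integral_derive_step_at _ _ ig ga.
have Cb := cvg_integral_derive_step_at _ _ ig gb.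
have Ch := cvg_integral_step_at _ _ _ ih ab.
have E n : \int[mu]_x (g x * derive1 (step_at a n) x) -
    \int[mu]_x (g x * derive1 (step_at b n) x) =
    - \int[mu]_x (h x * (step_at a n - step_at b n) x).
  rewrite -gh; last exact: test_function_step.
  pose D : set R := `[a, b + 1].
  have n1 : n.+1%:R^-1 <= 1 :> R by rewrite invf_le1 ?ler1n ?natS_gt0.
  have supp (c x : R) : a <= c <= b -> ~ D x -> g x * derive1 (step_at c n) x = 0.
    move=> /andP[ac cb] Dx; rewrite derive_step_at_out ?mulr0//.
    apply: contra_not Dx; rewrite /D/= !in_itv/= => /andP[cx xc].
    by rewrite (le_trans ac)//= (le_trans xc)// lerD.
  have D1 (x : R) : derive1 (step_at a n - step_at b n) x =
      derive1 (step_at a n) x - derive1 (step_at b n) x.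
    have Da := is_derive_step_at a n x; have Db := is_derive_step_at b n x.
    by rewrite derive1E derive_val.
  rewrite !(Rintegral_support D) => [|x xD|x xD|x xD]; last 3 first.
  - by rewrite D1 mulrBr !supp ?subrr// ab lexx.
  - by rewrite supp// ab lexx.
  - by rewrite supp// ab lexx.
  have ik c := integrable_mul_derive_step_at _ c n a (b + 1) ig.
  rewrite -RintegralB; [|exact: measurable_itv|exact: ik..].
  by apply: eq_Rintegral => x _; rewrite D1 mulrBr.
have H : g a - g b = - \int[mu]_(x in `[a, b]) h x.
  apply: (cvg_unique _ (cvgB Ca Cb)) => //.
  rewrite (_ : _ - _ = - (fun n =>
      \int[mu]_x (h x * (step_at a n - step_at b n) x))); first exact: cvgN.
  by apply/funext => n; rewrite !fctE -E.
by rewrite -[RHS]opprK -H; ring.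
Qed.

End du_bois_reymond.

(** * Orthonormal frames and the Frenet system *)

Section frames.
Context {R : realType}.
Implicit Types (u v w : 'cV[R]_3) (Q : 'M[R]_3).

(** Expressed by cross products only, the condition propagates along Frenet frames by uniqueness. It
    does not fix lengths, as the zero triple satisfies it. *)
Definition oriented u v w :=
  [/\ crossv v w = u, crossv w u = v & crossv u v = w].

(** All three squared lengths equal the triple product of the vectors, so they coincide, and their
    sum 3 makes each of them 1. *)
Lemma oriented_orthonormal u v w : oriented u v w ->
  dotv u u + dotv v v + dotv w w = 3 ->
  [/\ dotv u u = 1, dotv v v = 1 & dotv w w = 1] /\
  [/\ dotv u v = 0, dotv u w = 0 & dotv v w = 0].
Proof.
move=> [vw wu uv] s3.
have triple (x y z : 'cV[R]_3) : dotv (crossv x y) z = dotv x (crossv y z).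
  by rewrite !dotvE !cross_coordE; ring.
have orthol (x y : 'cV[R]_3) : dotv x (crossv x y) = 0 by rewrite !dotvE !cross_coordE; ring.
have orthor (x y : 'cV[R]_3) : dotv x (crossv y x) = 0 by rewrite !dotvE !cross_coordE; ring.
have := triple v w u; have := triple u v w.
have := orthor u w; have := orthol u v; have := orthor v u.
rewrite vw wu uv => vw0 uw0 uv0 ww vv.
by split; split; lra.
Qed.

Lemma det3E Q : \det Q = dotv (col 0 Q) (crossv (col 1 Q) (col 2%:R Q)).
Proof.
rewrite dotvE !cross_coordE !mxE.
rewrite (expand_det_col _ 0) !big_ord_recl big_ord0 /cofactor.
rewrite !(expand_det_col _ ord0) !big_ord_recl !big_ord0 /cofactor !det_mx11 !mxE.
(* The cofactor expansion yields nested lifts as indices; through [q] they compute to plain numbers,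
   and equal entries become syntactically equal for [ring]. *)
pose q (i j : nat) := Q (inord i) (inord j).
have qE i j : Q i j = q (val i) (val j) by rewrite /q !inord_val.
by rewrite !qE /= /bump /=; ring.
Qed.

Lemma dotv_colE Q i j : dotv (col i Q) (col j Q) = (Q^T *m Q) i j.
Proof. by rewrite /dotv mxE; apply: eq_bigr => k _; rewrite !mxE. Qed.

Lemma SO3_oriented Q : SO3 Q -> oriented (col 0 Q) (col 1 Q) (col 2%:R Q).
Proof.
move=> [QQ dQ]; set u := col 0 Q; set v := col 1 Q; set w := col 2%:R Q.
have E i j : dotv (col i Q) (col j Q) = (i == j)%:R.
  by rewrite dotv_colE QQ mxE.
have [uu vv ww] : [/\ dotv u u = 1, dotv v v = 1 & dotv w w = 1] by rewrite !E.
have [uv uw vw] : [/\ dotv u v = 0, dotv u w = 0 & dotv v w = 0] by rewrite !E.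
have det : dotv u (crossv v w) = 1 by rewrite -det3E.
(* Equality case of Cauchy-Schwarz: the square of [y x z - x] expands to [1 - 0 - 2 + 1 = 0]. *)
have aux (x y z : 'cV[R]_3) : dotv x x = 1 -> dotv y y = 1 -> dotv z z = 1 ->
    dotv y z = 0 -> dotv x (crossv y z) = 1 -> crossv y z = x.
  move=> xx yy zz yz d; apply/eqP; rewrite -subr_eq0; apply/eqP/dotv_eq0.
  have -> : dotv (crossv y z - x) (crossv y z - x) =
      dotv y y * dotv z z - dotv y z ^+ 2 - 2 * dotv x (crossv y z) + dotv x x.
    by rewrite !dotvE !(addvE, oppvE) !cross_coordE; ring.
  by rewrite xx yy zz yz d; ring.
split; apply: aux => //.
- by rewrite dotvC.
- by rewrite -det !dotvE !cross_coordE; ring.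
- by rewrite -det !dotvE !cross_coordE; ring.
Qed.

Lemma oriented_SO3 u v w : oriented u v w ->
  dotv u u = 1 -> dotv v v = 1 -> dotv w w = 1 ->
  exists2 Q, SO3 Q & [/\ col 0 Q = u, col 1 Q = v & col 2%:R Q = w].
Proof.
move=> uvw uu vv ww.
pose Q : 'M[R]_3 := \matrix_(i, j) (if j == 0 then u else if j == 1 then v else w) i 0.
have [Q0 Q1 Q2] : [/\ col 0 Q = u, col 1 Q = v & col 2%:R Q = w].
  by split; apply/colP => i; rewrite !mxE.
exists Q => //; split.
  have [_ [uv uw vw]] : [/\ dotv u u = 1, dotv v v = 1 & dotv w w = 1] /\
      [/\ dotv u v = 0, dotv u w = 0 & dotv v w = 0].
    by apply: oriented_orthonormal => //; rewrite uu vv ww; ring.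
  apply/matrixP => i j; rewrite -dotv_colE mxE; move: i j.
  by apply: ord3P; apply: ord3P; rewrite ?Q0 ?Q1 ?Q2 ?uu ?vv ?ww// dotvC.
have [vw _ _] := uvw.
by rewrite det3E Q0 Q1 Q2 vw.
Qed.

Lemma oriented_frame u v : dotv u u = 1 -> dotv v v = 1 -> dotv u v = 0 ->
  oriented u v (crossv u v).
Proof.
move=> uu vv uv; split=> //.
- by rewrite double_cross vv (dotvC v u) uv scale1r scale0r subr0.
- by rewrite crossvC double_cross uu uv scale1r scale0r sub0r opprK.
Qed.

(** To be read with [u = f], [v = G/|G|], [w] the unit tangent and [u' = k w]: the left side is then
    the derivative of [w = a v - b u x v]. The components along [w] cancel, those along [u] add up
    to [-(a^2 + b^2) k], and what remains is the torsion term. *)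
Lemma frame_derivative (a b k x : R) u v w dv : a ^+ 2 + b ^+ 2 = 1 ->
  dotv u u = 1 -> dotv v v = 1 -> dotv u v = 0 ->
  w = a *: v - b *: crossv u v ->
  dv = - (a * x / 2) *: v + (x / 2) *: w - (a * k) *: u ->
  a *: dv - b *: (crossv (k *: w) v + crossv u dv) =
  - k *: u + (- (b * x / 2)) *: crossv u w.
Proof.
move=> ab uu vv uv wE dvE.
have -> : crossv (k *: w) v = (k * b) *: u.
  rewrite crossvC crossvZr wE crossvDr crossvZr crossvv scaler0 add0r.
  rewrite crossvNr crossvZr double_cross vv (dotvC v u) uv scale1r scale0r subr0.
  by rewrite scalerN opprK scalerA.
have -> : crossv u dv = - (a * x / 2) *: crossv u v + (x / 2) *: crossv u w.
  by rewrite dvE !crossvDr !crossvZr crossvNr crossvZr crossvv scaler0 subr0.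
apply/colP => i; rewrite !(addvE,oppvE,scalevE) dvE !(addvE,oppvE,scalevE).
have -> : - k * u i 0 = - ((a ^+ 2 + b ^+ 2) * k) * u i 0 by rewrite ab mul1r.
rewrite (congr1 (fun w : 'cV[R]_3 => w i 0) wE) !(addvE,oppvE,scalevE).
by ring.
Qed.

End frames.

(** * The Frenet system: uniqueness, symmetries, existence, smoothness *)

Section frenet.
Context {R : realType}.
Implicit Types (k tau : R -> R) (m n b : R -> 'cV[R]_3).

(** The bare linear system, free of initial values and of smoothness, so that differences, rotations
    and cross products of solutions are again solutions. *)
Definition frenet k tau m n b := forall x : R,
  [/\ is_derive x 1 m (k x *: n x),
      is_derive x 1 n (- k x *: m x + tau x *: b x)
    & is_derive x 1 b (- tau x *: n x)].

(** The coefficient matrix is skew-symmetric. Applied to a difference of solutions this gives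
    uniqueness; applied to a frame it keeps the sum of squares equal to 3. *)
Lemma frenet_energy k tau m n b x : frenet k tau m n b ->
  dotv (m x) (m x) + dotv (n x) (n x) + dotv (b x) (b x) =
  dotv (m 0) (m 0) + dotv (n 0) (n 0) + dotv (b 0) (b 0).
Proof.
move=> F.
apply: (is_derive_0_is_cst x 0 (f :=
  (fun x => dotv (m x) (m x)) + (fun x => dotv (n x) (n x))
   + (fun x => dotv (b x) (b x)))) => t.
have [Dm Dn Db] := F t.
have D1 := is_derive_dotv _ _ _ _ _ Dm Dm.
have D2 := is_derive_dotv _ _ _ _ _ Dn Dn.
have D3 := is_derive_dotv _ _ _ _ _ Db Db.
by apply: is_derive_eq; rewrite !dotvE !mxE; ring.
Qed.

Lemma frenetB k tau m n b m' n' b' :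
  frenet k tau m n b -> frenet k tau m' n' b' ->
  frenet k tau (m - m') (n - n') (b - b').
Proof.
move=> F F' x; have [Dm Dn Db] := F x; have [Dm' Dn' Db'] := F' x.
split; apply: is_derive_eq; rewrite !fctE.
- by rewrite scalerBr.
- by rewrite !scalerBr opprD addrACA.
- by rewrite scalerBr.
Qed.

Lemma frenet_unique k tau m n b m' n' b' :
  frenet k tau m n b -> frenet k tau m' n' b' ->
  m 0 = m' 0 -> n 0 = n' 0 -> b 0 = b' 0 ->
  [/\ m = m', n = n' & b = b'].
Proof.
move=> F F' m0 n0 b0.
have E x : [/\ m x = m' x, n x = n' x & b x = b' x].
  have := frenet_energy _ _ _ _ _ x (frenetB _ _ _ _ _ _ _ _ F F').
  rewrite !fctE m0 n0 b0 !subrr.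
  have -> : dotv (0 : 'cV[R]_3) 0 = 0 by rewrite dotvE !mxE; ring.
  have := dotv_ge0 (m x - m' x); have := dotv_ge0 (n x - n' x).
  have := dotv_ge0 (b x - b' x) => B N M S.
  split; apply/eqP; rewrite -subr_eq0; apply/eqP/dotv_eq0; lra.
by split; apply/funext => x; have [] := E x.
Qed.

(** With uniqueness, an oriented triple at 0 stays oriented: the cross products and the frame solve
    the same system with the same initial value. *)
Lemma frenet_cross k tau m n b : frenet k tau m n b ->
  frenet k tau (fun x => crossv (n x) (b x)) (fun x => crossv (b x) (m x))
    (fun x => crossv (m x) (n x)).
Proof.
move=> F x; have [Dm Dn Db] := F x.
have D1 := is_derive_crossv _ _ _ _ _ Dn Db.
have D2 := is_derive_crossv _ _ _ _ _ Db Dm.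
have D3 := is_derive_crossv _ _ _ _ _ Dm Dn.
by split; apply: is_derive_eq;
  apply: cv3P; rewrite !(cross_coordE, mxE); ring.
Qed.

Lemma is_derive_mulmx (Q : 'M[R]_3) (f : R -> 'cV[R]_3) (x : R) df :
  is_derive x 1 f df -> is_derive x 1 (fun t => Q *m f t) (Q *m df).
Proof.
move=> /is_derive_mxP Df; apply/is_derive_mxP => i.
rewrite (_ : (fun t => _) = \sum_j (cst (Q i j) * (fun t => f t j 0))); last first.
  by apply/funext => t; rewrite mxE fct_sumE.
by apply: is_derive_eq; rewrite mxE; apply: eq_bigr => j _;
  rewrite /GRing.scale/=; ring.
Qed.

Lemma frenet_mulmx k tau m n b Q : frenet k tau m n b ->
  frenet k tau (fun x => Q *m m x) (fun x => Q *m n x) (fun x => Q *m b x).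
Proof.
move=> F x; have [Dm Dn Db] := F x.
split; apply: is_derive_eq.
- exact: is_derive_mulmx.
- by rewrite scalemxAr.
- exact: is_derive_mulmx.
- by rewrite mulmxDr !scalemxAr.
- exact: is_derive_mulmx.
- by rewrite scalemxAr.
Qed.

Lemma frenet_oriented k tau m n b : frenet k tau m n b ->
  oriented (m 0) (n 0) (b 0) -> forall x, oriented (m x) (n x) (b x).
Proof.
move=> F [nb bm mn] x.
have [Em En Eb] := frenet_unique _ _ _ _ _ _ _ _ (frenet_cross _ _ _ _ _ F) F nb bm mn.
split.
- by rewrite -[RHS](congr1 (@^~ x) Em).
- by rewrite -[RHS](congr1 (@^~ x) En).
- by rewrite -[RHS](congr1 (@^~ x) Eb).
Qed.

(** The system does not mix the coordinates of space: for each [i], this matrix acts on the triple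
    formed by the [i]-th coordinates of [m], [n], [b]. *)
Definition frenet_mx k tau (x : R) : 'M[R]_3 :=
  k x *: (delta_mx 0 1 - delta_mx 1 0) + tau x *: (delta_mx 1 2%:R - delta_mx 2%:R 1).

Lemma frenet_mxE k tau x (y : 'cV[R]_3) :
  [/\ (frenet_mx k tau x *m y) 0 0 = k x * y 1 0,
      (frenet_mx k tau x *m y) 1 0 = - k x * y 0 0 + tau x * y 2%:R 0
    & (frenet_mx k tau x *m y) 2%:R 0 = - tau x * y 1 0].
Proof.
have E i : (frenet_mx k tau x *m y) i 0 =
   frenet_mx k tau x i 0 * y 0 0 + frenet_mx k tau x i 1 * y 1 0
   + frenet_mx k tau x i 2%:R * y 2%:R 0.
  rewrite mxE !big_ord_recr big_ord0/= add0r.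
  by congr (_ * _ + _ * _ + _ * _); (congr (y _ _) || congr (frenet_mx _ _ _ _ _));
    apply/val_inj.
by rewrite !E !mxE /=; split; ring.
Qed.

Lemma frenet_exists k tau : continuous k -> continuous tau ->
  exists m n b, [/\ frenet k tau m n b,
    m 0 = delta_mx 0 0, n 0 = delta_mx 1 0 & b 0 = delta_mx 2%:R 0].
Proof.
move=> ck ct.
have cA i j : continuous (fun t => frenet_mx k tau t i j).
  rewrite (_ : (fun t => _) = (k * cst ((delta_mx 0 1 - delta_mx 1 0 : 'M[R]_3) i j))
      + (tau * cst ((delta_mx 1 2%:R - delta_mx 2%:R 1 : 'M[R]_3) i j))); last first.
    by apply/funext => t; rewrite !mxE.
  by move=> x; apply: continuousD; apply: continuousM; (exact: ck || exact: ct ||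
    exact: cst_continuous).
(* One solution for each coordinate [i] of space; as the initial frame is the identity matrix, its
   initial value is the [i]-th basis vector. *)
have [y Hy] := choice (fun i : 'I_3 => linear_ode_exists 3 _ (delta_mx i 0) cA).
exists (fun x => \col_i y i x 0 0), (fun x => \col_i y i x 1 0),
  (fun x => \col_i y i x 2%:R 0); split.
- move=> x; split; apply/is_derive_mxP => i; rewrite ?mxE;
    under eq_fun do rewrite mxE; have [_ /(_ x)/is_derive_mxP D] := Hy i;
    have [E0 E1 E2] := frenet_mxE k tau x (y i x); rewrite ?mxE.
  + by rewrite -E0; exact: D.
  + by rewrite -E1; exact: D.
  + by rewrite -E2; exact: D.
- by apply/colP => i; rewrite !mxE (proj1 (Hy i)) !mxE eqxx eq_sym andbT.
- by apply/colP => i; rewrite !mxE (proj1 (Hy i)) !mxE eqxx eq_sym andbT.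
- by apply/colP => i; rewrite !mxE (proj1 (Hy i)) !mxE eqxx eq_sym andbT.
Qed.

Lemma Ck_coord p (f : R -> 'cV[R]_p) i j :
  Ck j f -> Ck j (fun x => f x i 0).
Proof.
elim: j f => [//|j IH] f Cf; apply: (CkSP _ _ (fun x => derive1 f x i 0)).
  by move=> x; have /is_derive_mxP := CkS_is_derive _ _ _ Cf x; apply.
by apply: IH; case: Cf.
Qed.

Lemma Ck_scalev p (f : R -> R) (v : R -> 'cV[R]_p) j :
  Ck j f -> Ck j v -> Ck j (fun x => f x *: v x).
Proof.
move=> Cf Cv; apply: Ck_col => i; under eq_fun do rewrite mxE.
by apply: CkM => //; exact: Ck_coord.
Qed.

(** Bootstrap on the three vectors at once: the right-hand sides are as regular as the vectors,
    which therefore gain one derivative. *)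
Lemma frenet_smooth k tau m n b : (forall j, Ck j k) -> (forall j, Ck j tau) ->
  frenet k tau m n b -> [/\ smooth m, smooth n & smooth b].
Proof.
move=> Ckk Ct F.
suff H j : [/\ Ck j m, Ck j n & Ck j b].
  by split; apply/smoothP => j; have [] := H j.
elim: j => [//|j [Cm Cn Cb]].
have CN (f : R -> R) : Ck j f -> Ck j (fun x => - f x) := @CkN R f j.
split.
- apply: (CkSP _ _ (fun x => k x *: n x)); last exact: Ck_scalev.
  by move=> x; have [] := F x.
- apply: (CkSP _ _ ((fun x => - k x *: m x) + (fun x => tau x *: b x))).
    by move=> x; have [] := F x.
  by apply: CkD; apply: Ck_scalev => //; apply: CN.
- apply: (CkSP _ _ (fun x => - tau x *: n x)).
    by move=> x; have [] := F x.
  by apply: Ck_scalev => //; apply: CN.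
Qed.

Lemma is_derive_curvature (c alpha x : R) :
  is_derive x 1 (curvature c alpha) (alpha * x / 2 * curvature c alpha x).
Proof.
rewrite (_ : curvature c alpha =
  cst c * (expR \o (cst (alpha / 4) * (id ^+ 2)))); last first.
  by apply/funext => y; rewrite /curvature !fctE/=; congr (_ * expR _); ring.
by apply: is_derive_eq; rewrite !fctE /GRing.scale/=; field.
Qed.

Lemma Ck_curvature (c alpha : R) j : Ck j (curvature c alpha).
Proof.
elim: j => [//|j IH]; apply: CkSP (is_derive_curvature c alpha) _.
apply: (CkM (fun x => alpha * x / 2)) => //.
rewrite (_ : (fun x => _) = cst (alpha / 2) * id).
  by apply: CkM; [exact: Ck_cst|exact: Ck_id].
by apply/funext => x; rewrite !fctE; ring.
Qed.

Lemma Ck_torsion (beta : R) j : Ck j (torsion beta).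
Proof.
rewrite (_ : torsion beta = cst (- beta / 2) * id).
  by apply: CkM; [exact: Ck_cst|exact: Ck_id].
by apply/funext => x; rewrite /torsion !fctE; ring.
Qed.

Lemma Ck1_continuous (f : R -> R) : Ck 1 f -> continuous f.
Proof.
by move=> Cf x; apply: is_derive_continuous; exact: (CkS_is_derive _ _ 0 Cf).
Qed.

Lemma serret_frenetP (c alpha beta : R) m n b :
  serret_frenet c alpha beta m n b <->
  frenet (curvature c alpha) (torsion beta) m n b /\
  [/\ m 0 = delta_mx 0 0, n 0 = delta_mx 1 0 & b 0 = delta_mx 2%:R 0].
Proof.
split=> [[[sm sn sb] F init]|[F init]].
  split=> // x; have [Em En Eb] := F x.
  by split; apply: DeriveDef; rewrite -?derive1E//;
    [exact: (sm 0%N)|exact: (sn 0%N)|exact: (sb 0%N)].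
split=> //; first exact: frenet_smooth (Ck_curvature _ _) (Ck_torsion _) F.
by move=> x; have [[_ Em] [_ En] [_ Eb]] := F x; rewrite !derive1E.
Qed.

(** Global existence rules out the default value of [xget]. *)
Lemma frenet_mP (c alpha beta : R) : exists n b,
  frenet (curvature c alpha) (torsion beta) (frenet_m c alpha beta) n b /\
  [/\ frenet_m c alpha beta 0 = delta_mx 0 0, n 0 = delta_mx 1 0
    & b 0 = delta_mx 2%:R 0].
Proof.
have [|| m [n [b [F m0 n0 b0]]]] := frenet_exists (curvature c alpha) (torsion beta).
- exact/Ck1_continuous/Ck_curvature.
- exact/Ck1_continuous/Ck_torsion.
rewrite /frenet_m; case: xgetP => [m' _ [n' [b' /serret_frenetP SF]]|/(_ m)[]].
  by exists n', b'.
by exists n, b; apply/serret_frenetP.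
Qed.

End frenet.

(** * Regularity of weak solutions *)

Section integrability.
Context {R : realType}.
Local Notation mu := (@lebesgue_measure R).
Local Notation measurable_R h :=
  (measurable_fun setT (h : measurableTypeR R -> measurableTypeR R)).

Lemma segment_integrable_dominated (F G : R -> R) : measurable_R F ->
  segment_integrable G -> (forall x, `|F x| <= G x) -> segment_integrable F.
Proof.
move=> mF iG FG a b; apply: (le_integrable _ _ _ (iG a b)) => //.
- by apply/measurable_EFinP; apply: measurable_funS mF.
- by move=> x _ /=; rewrite lee_fin (le_trans (FG x)) ?ler_norm.
Qed.

Lemma segment_integrableD (f g : R -> R) : segment_integrable f -> segment_integrable g ->
  segment_integrable (fun x => f x + g x).
Proof.
move=> fi gi a b.
rewrite (_ : EFin \o _ = ((EFin \o f) \+ (EFin \o g))%E)//.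
exact: (integrableD _ (fi _ _) (gi _ _)).
Qed.

Lemma segment_integrable_mulc (g phi : R -> R) : segment_integrable g ->
  continuous phi -> segment_integrable (fun x => g x * phi x).
Proof.
move=> ig cphi a b.
have [B B0 HB] := continuous_bounded phi (Num.max `|a| `|b|) cphi.
have mg : measurable_fun `[a, b] g.
  by have /integrableP[/measurable_EFinP] := ig a b.
apply: (le_integrable _ _ _ (integrableZl _ B (ig a b))) => //.
- apply/measurable_EFinP; apply: measurable_funM => //.
  by apply: measurable_funTS; exact: continuous_measurable_fun.
- move=> x /=; rewrite in_itv/= => /andP[ax xb].
  rewrite lee_fin !normrM mulrC ler_wpM2r// (ger0_norm B0) HB//.
  rewrite le_max; apply/orP; have [x0|x0] := leP 0 x; [right|left].
    by rewrite (ger0_norm x0) (le_trans xb)// ler_norm.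
  by rewrite (ltr0_norm x0) -normrN (le_trans _ (ler_norm _))// lerN2.
Qed.

Lemma segment_integrable_locally (g : R -> R) : measurable_R g ->
  segment_integrable g -> locally_integrable setT g.
Proof.
move=> mg ig; split => //; first exact: openT.
move=> K _ cK; have [M [Mr HM]] := compact_bounded cK.
have Kseg : K `<=` `[- (M + 1), M + 1].
  by move=> x Kx; rewrite /= in_itv/= -ler_norml; apply: HM => //; rewrite ltrDl.
have /integrableP[_] := ig (- (M + 1)) (M + 1); apply: le_lt_trans.
apply: ge0_subset_integral => //=.
- exact: compact_measurable.
- by apply/measurable_EFinP; apply: measurableT_comp => //; exact: measurable_funTS.
Qed.

Lemma L2_segment_integrable (g : R -> R) : measurable_R g ->
  segment_integrable (fun x => g x ^+ 2) -> segment_integrable g.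
Proof.
move=> mg ig.
apply: (segment_integrable_dominated g (fun x => g x ^+ 2 + 1)) => //.
  exact/segment_integrableD/segment_integrable_cst.
by move=> x; rewrite -real_normK ?num_real//; have := normr_ge0 (g x); nra.
Qed.

Lemma primitive_ae_eq (g h : R -> R) : segment_integrable g -> segment_integrable h ->
  {ae mu, forall x, g x = h x} -> primitive g = primitive h.
Proof.
move=> ig ih gh.
have E a b : \int[mu]_(x in `[a, b]) g x = \int[mu]_(x in `[a, b]) h x.
  rewrite /Rintegral; congr fine; apply: ae_eq_integral => //.
  - by have /integrableP[] := ig a b.
  - by have /integrableP[] := ih a b.
  - have FF := ae_filter_ringOfSetsType mu.
    by apply: filterS gh => x -> _.
by apply/funext => x; rewrite /primitive !E.
Qed.

Lemma ae_exists (P : R -> Prop) : {ae mu, forall x, P x} -> exists x, P x.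
Proof.
have mu0 : (0 < mu [set: R])%E.
  apply: (@lt_le_trans _ _ (mu `[0, 1])).
    by rewrite lebesgue_measure_itv/= lte_fin ltr01 oppr0 adde0 lte_fin ltr01.
  by apply: le_measure => //; rewrite inE//; exact: measurable_itv.
have FF := ae_properfilter_algebraOfSetsType mu0.
by move=> /filter_ex.
Qed.

(** The derivative vanishes as well because the complement of the segment is open, so [phi] is zero
    near each of its points. *)
Lemma test_function_bounded (V : normedModType R) (phi : R -> V) :
  test_function phi ->
  exists2 N, 0 <= N & forall x, ~ `[- N, N] x -> phi x = 0 /\ derive1 phi x = 0.
Proof.
move=> [_ /compact_bounded[M [Mr HM]]].
set N := `|M| + 1.
have H0 x : N < `|x| -> phi x = 0.
  move=> Nx; apply/eqP; apply: contraT => phix.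
  have : `|x| <= N.
    apply: (HM N); first by rewrite /N (le_lt_trans (ler_norm M))// ltrDl.
    exact: subset_closure.
  by rewrite leNgt Nx.
exists N => [|x]; first by rewrite addr_ge0.
rewrite /= in_itv/= -ler_norml => /negP; rewrite -ltNge => Nx; split; first exact: H0.
rewrite derive1E (@near_eq_derive _ _ _ _ (cst 0)) ?derive_cst//.
near=> y; apply: H0; near: y.
have : `|y| @[y --> x] --> `|x| by exact: norm_continuous.
by move/cvgr_gt; apply.
Unshelve. all: by end_near. Qed.

End integrability.

(** * The weak equation, coordinate by coordinate *)

Section weak_form.
Context {R : realType}.
Local Notation mu := (@lebesgue_measure R).
Local Notation measurable_R h :=
  (measurable_fun setT (h : measurableTypeR R -> measurableTypeR R)).

Lemma dotv_delta (u : 'cV[R]_3) (c : R) i :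
  dotv u (c *: delta_mx i 0) = c * u i 0.
Proof. by rewrite dotvE !mxE; move: i; apply: ord3P; rewrite /=; ring. Qed.

Lemma is_derive_delta (psi : R -> R) i (x dpsi : R) : is_derive x 1 psi dpsi ->
  is_derive x 1 (fun t => psi t *: (delta_mx i 0 : 'cV[R]_3)) (dpsi *: delta_mx i 0).
Proof.
move=> Dp; have Dc := is_derive_cst (delta_mx i 0 : 'cV[R]_3) x 1.
have := is_derive_scalev _ _ _ _ _ _ Dp Dc.
by rewrite scaler0 addr0.
Qed.

Lemma test_function_delta (psi : R -> R) i : test_function psi ->
  test_function (fun t => psi t *: (delta_mx i 0 : 'cV[R]_3)).
Proof.
move=> [spsi cpsi]; split.
  apply/smoothP => k; apply: Ck_scalev; last exact: Ck_cst.
  by move: k; exact/smoothP.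
apply: subclosed_compact cpsi _; first exact: closed_closure.
apply: closure_subset => x /=; apply: contra_neq => ->.
by rewrite scale0r.
Qed.

Variables (alpha beta : R) (f df : R -> 'cV[R]_3).
Hypothesis fdf : H1loc_S2 f df.

(* The equation in divergence form is flux' = source. *)
Definition flux x := alpha *: df x + beta *: crossv (f x) (df x).
Definition source x := (x / 2) *: df x - (alpha * dotv (df x) (df x)) *: f x.

Lemma continuous_coord (g : R -> 'cV[R]_3) i : continuous g ->
  continuous (fun x => g x i 0).
Proof.
move=> cg x; apply: (@continuous_comp _ _ _ g (fun M : 'cV[R]_3 => M i 0)).
  exact: cg.
exact: coord_continuous.
Qed.

Lemma f_coord_continuous i : continuous (fun x => f x i 0).
Proof. by have [cf _ _ _ _] := fdf; exact: continuous_coord. Qed.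

Lemma df_coord_measurable i : measurable_R (fun x => df x i 0).
Proof. by have [_ _ _ L2 _] := fdf; have [] := L2 i. Qed.

Lemma f_coord_measurable i : measurable_R (fun x => f x i 0).
Proof. by apply: continuous_measurable_fun; exact: f_coord_continuous. Qed.

Lemma df_sqr_integrable i : segment_integrable (fun x => df x i 0 ^+ 2).
Proof.
have [_ _ _ L2 _] := fdf; have [_ H] := L2 i.
exact: locally_integrable_segment.
Qed.

Lemma df_coord_integrable i : segment_integrable (fun x => df x i 0).
Proof.
exact: L2_segment_integrable (df_coord_measurable i) (df_sqr_integrable i).
Qed.

Lemma df_dotv_integrable : segment_integrable (fun x => dotv (df x) (df x)).
Proof.
under eq_fun do rewrite dotvE -!expr2.
by do 2?apply: segment_integrableD; exact: df_sqr_integrable.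
Qed.

(** Arranged as integrable factors times continuous ones, the shape that [segment_integrable_mulc]
    handles. *)
Lemma flux_coordE i x : flux x i 0 = df x i 0 * alpha +
  (df x (i + 2%:R) 0 * (beta * f x (i + 1) 0) +
   df x (i + 1) 0 * (- beta * f x (i + 2%:R) 0)).
Proof. by rewrite !mxE; ring. Qed.

Lemma source_coordE i x : source x i 0 =
  df x i 0 * (x / 2) + dotv (df x) (df x) * (- alpha * f x i 0).
Proof. by rewrite !mxE; ring. Qed.

Lemma flux_integrable i : segment_integrable (fun x => flux x i 0).
Proof.
under eq_fun do rewrite flux_coordE.
apply: segment_integrableD; last apply: segment_integrableD;
  apply: segment_integrable_mulc; try exact: df_coord_integrable.
- by move=> x; exact: cst_continuous.
- by move=> x; apply: continuousM; [exact: cst_continuous|exact: f_coord_continuous].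
- by move=> x; apply: (@continuousM _ _ (cst (- beta)));
    [exact: cst_continuous|exact: f_coord_continuous].
Qed.

Lemma source_integrable i : segment_integrable (fun x => source x i 0).
Proof.
under eq_fun do rewrite source_coordE.
apply: segment_integrableD; apply: segment_integrable_mulc.
- exact: df_coord_integrable.
- by move=> x; apply: (@continuousM _ _ id (cst 2^-1)); [exact: cvg_id|exact: cst_continuous].
- exact: df_dotv_integrable.
- by move=> x; apply: (@continuousM _ _ (cst (- alpha)));
    [exact: cst_continuous|exact: f_coord_continuous].
Qed.

Lemma flux_measurable i : measurable_R (fun x => flux x i 0).
Proof.
under eq_fun do rewrite flux_coordE.
by do 2?apply: measurable_funD; do ?apply: measurable_funM;
  (exact: df_coord_measurable || exact: f_coord_measurable || exact: measurable_cst).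
Qed.

Lemma continuous_derive_test (psi : R -> R) : test_function psi ->
  continuous psi /\ continuous (derive1 psi).
Proof.
move=> [/smoothP Cpsi _]; split; apply: Ck1_continuous; first exact: Cpsi.
by have [] := Cpsi 2.
Qed.

Hypothesis weak : forall phi : R -> 'cV[R]_3, test_function phi ->
  \int[mu]_x
    (- (alpha * dotv (df x) (derive1 phi x))
     + alpha * dotv (df x) (df x) * dotv (f x) (phi x)
     - beta * dotv (crossv (f x) (df x)) (derive1 phi x)
     - x / 2 * dotv (df x) (phi x)) = 0.

(** The test field [psi e_i] isolates the [i]-th coordinate, and the integrand becomes minus the sum
    of the two products below. *)
Lemma weak_coord i (psi : R -> R) : test_function psi ->
  \int[mu]_x (flux x i 0 * derive1 psi x) = - \int[mu]_x (source x i 0 * psi x).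
Proof.
move=> tpsi; have [cpsi cdpsi] := continuous_derive_test _ tpsi.
have [N N0 HN] := test_function_bounded _ _ tpsi.
have := weak _ (test_function_delta _ i tpsi).
under eq_Rintegral => x _.
  have -> : derive1 (fun t => psi t *: (delta_mx i 0 : 'cV[R]_3)) x =
      derive1 psi x *: delta_mx i 0.
    have [spsi _] := tpsi; rewrite [LHS]derive1E.
    have Dp : is_derive x 1 psi (derive1 psi x).
      by rewrite derive1E; apply: derivableP; exact: (spsi 0%N).
    by have [] := is_derive_delta _ i _ _ Dp.
  rewrite !dotv_delta.
  rewrite (_ : _ - _ = - (flux x i 0 * derive1 psi x + source x i 0 * psi x)); last first.
    by rewrite flux_coordE source_coordE !mxE; ring.
  over.
(* Splitting the integral requires integrability, which is at hand on segments; hence the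
   restriction to one containing the support. *)
have supp (h g : R -> R) : (forall x, ~ `[- N, N] x -> g x = 0) ->
    \int[mu]_x (h x * g x) = \int[mu]_(x in `[- N, N]) (h x * g x).
  by move=> g0; apply: Rintegral_support => x /g0 ->; rewrite mulr0.
rewrite (supp (fun x => flux x i 0)) => [|x /HN[]//].
rewrite (supp (fun x => source x i 0)) => [|x /HN[]//].
rewrite (Rintegral_support `[- N, N]); last first.
  by move=> x /HN[-> ->]; rewrite !mulr0 addr0 oppr0.
have i1 := segment_integrable_mulc _ _ (flux_integrable i) cdpsi (- N) N.
have i2 := segment_integrable_mulc _ _ (source_integrable i) cpsi (- N) N.
under eq_Rintegral do rewrite -mulN1r.
rewrite RintegralZl//; last first.
  exact: (segment_integrableD _ _ (segment_integrable_mulc _ _ (flux_integrable i) cdpsi)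
   (segment_integrable_mulc _ _ (source_integrable i) cpsi)).
by rewrite RintegralD// => H; apply/eqP; rewrite -subr_eq0; apply/eqP; lra.
Qed.

End weak_form.

(** * From almost everywhere identities to C^1 regularity *)

Section regularity.
Context {R : realType}.
Local Notation mu := (@lebesgue_measure R).

Lemma increment_primitive (P : R -> Prop) (F h : R -> R) : segment_integrable h ->
  (forall a b, a <= b -> P a -> P b -> F b - F a = \int[mu]_(x in `[a, b]) h x) ->
  forall a b, P a -> P b -> F b = F a + (primitive h b - primitive h a).
Proof.
move=> ih H a b Pa Pb; have [ab|/ltW ba] := leP a b.
  by rewrite primitiveB// -H//; ring.
by rewrite -[_ - _]opprB primitiveB// -H//; ring.
Qed.

Variables (alpha beta : R) (f df : R -> 'cV[R]_3).
Hypothesis alphabeta : alpha ^+ 2 + beta ^+ 2 = 1.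
Hypothesis fdf : H1loc_S2 f df.
Hypothesis weak : forall phi : R -> 'cV[R]_3, test_function phi ->
  \int[mu]_x
    (- (alpha * dotv (df x) (derive1 phi x))
     + alpha * dotv (df x) (df x) * dotv (f x) (phi x)
     - beta * dotv (crossv (f x) (df x)) (derive1 phi x)
     - x / 2 * dotv (df x) (phi x)) = 0.
Local Notation flux := (flux alpha beta f df).
Local Notation source := (source alpha f df).

Definition lebesgue_regular x :=
  (forall i, lebesgue_pt (fun t => df t i 0) x) /\
  (forall i, lebesgue_pt (fun t => flux t i 0) x).

Lemma ae_lebesgue_regular : {ae mu, forall x, lebesgue_regular x}.
Proof.
have FF := ae_filter_ringOfSetsType mu.
have H1 : {ae mu, forall x, forall i, lebesgue_pt (fun t => df t i 0) x}.
  apply: filter_forall => i; apply: lebesgue_differentiation.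
  apply: segment_integrable_locally; first exact: df_coord_measurable fdf i.
  exact: df_coord_integrable fdf i.
have H2 : {ae mu, forall x, forall i, lebesgue_pt (fun t => flux t i 0) x}.
  apply: filter_forall => i; apply: lebesgue_differentiation.
  apply: segment_integrable_locally; first exact: flux_measurable fdf i.
  exact: flux_integrable fdf i.
by apply: filterS2 H1 H2.
Qed.

(** Valid for all [a] and [b], since every point is a Lebesgue point of the continuous [f]; for the
    flux the same argument is confined to regular points. *)
Lemma f_increment i a b :
  f b i 0 = f a i 0 + (primitive (fun t => df t i 0) b
                       - primitive (fun t => df t i 0) a).
Proof.
have [cf _ _ _ wd] := fdf.
have cfi := f_coord_continuous _ _ fdf i.
have ifi := continuous_segment_integrable _ cfi.
apply: (increment_primitive (fun=> True) (fun t => f t i 0)) => //.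
  exact: df_coord_integrable fdf i.
move=> {}a {}b ab _ _; apply: (du_bois_reymond (fun t => f t i 0)) => //.
- exact: df_coord_integrable fdf i.
- exact: wd.
- by apply: continuous_segment_lebesgue_pt => //; exact: cfi.
- by apply: continuous_segment_lebesgue_pt => //; exact: cfi.
Qed.

Lemma flux_increment i a b : lebesgue_regular a -> lebesgue_regular b ->
  flux b i 0 = flux a i 0 + (primitive (fun t => source t i 0) b
                             - primitive (fun t => source t i 0) a).
Proof.
apply: (increment_primitive lebesgue_regular (fun t => flux t i 0)) => //.
  exact: source_integrable fdf i.
move=> {}a {}b ab [_ La] [_ Lb].
apply: (du_bois_reymond (fun t => flux t i 0)) => //.
- exact: flux_integrable fdf i.
- exact: source_integrable fdf i.
- exact: weak_coord fdf weak i.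
Qed.

Lemma dotv_f_deriv (x : R) d : is_derive x 1 f d -> dotv (f x) d = 0.
Proof.
move=> Df; have D := is_derive_dotv _ _ _ _ _ Df Df.
have [_ S _ _ _] := fdf.
have E : (fun t => dotv (f t) (f t)) = cst 1 by apply/funext => t; exact: S.
have [_] := D; rewrite E derive_cst dotvC; lra.
Qed.

(** At a Lebesgue point of [df], the representation of [f] as a primitive makes [df x] a true
    derivative. Hence it is orthogonal to [f x], and the rotation defining the flux can be
    inverted. *)
Lemma df_eq_flux x : lebesgue_regular x ->
  df x = alpha *: flux x - beta *: crossv (f x) (flux x).
Proof.
move=> [Ld _]; have [_ S _ _ _] := fdf.
have D : is_derive x 1 f (df x).
  apply/is_derive_mxP => i.
  have Dp := is_derive_primitive_lebesgue_pt _ _ (df_coord_integrable _ _ fdf i) (Ld i).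
  rewrite (_ : (fun t => _) = cst (f 0 i 0) + primitive (fun t => df t i 0)).
    by apply: is_derive_eq; rewrite add0r.
  by apply/funext => t; rewrite (f_increment i 0 t) primitive0 subr0.
apply/esym/flux_inversion => //; first exact: S.
exact: dotv_f_deriv D.
Qed.

Theorem weak_solution_C1 : exists G : R -> 'cV[R]_3, forall x : R,
  is_derive x 1 f (alpha *: G x - beta *: crossv (f x) (G x)) /\
  (let v := alpha *: G x - beta *: crossv (f x) (G x) in
   is_derive x 1 G ((x / 2) *: v - (alpha * dotv v v) *: f x)).
Proof.
(* Any regular point can serve as base point: [G] takes there the value of the flux and is continued
   by integrating the source. *)
have [a La] := ae_exists _ ae_lebesgue_regular.
pose G x : 'cV[R]_3 := \col_i (flux a i 0 + (primitive (fun t => source t i 0) x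
                             - primitive (fun t => source t i 0) a)).
have Gdef x i : G x i 0 = flux a i 0 + (primitive (fun t => source t i 0) x
    - primitive (fun t => source t i 0) a) by rewrite [LHS]mxE.
clearbody G.
have GE x : lebesgue_regular x -> flux x = G x.
  by move=> Lx; apply/colP => i; rewrite Gdef; exact: (flux_increment i a x La Lx).
pose v x := alpha *: G x - beta *: crossv (f x) (G x).
pose H x := (x / 2) *: v x - (alpha * dotv (v x) (v x)) *: f x.
have dfE x : lebesgue_regular x -> df x = v x.
  by move=> Lx; rewrite df_eq_flux// GE.
have sourceE x : lebesgue_regular x -> source x = H x.
  by move=> Lx; rewrite /source /H dfE.
have cf i : continuous (fun x => f x i 0) := f_coord_continuous _ _ fdf i.
have cG i : continuous (fun x => G x i 0).
  rewrite (_ : (fun x => _) = cst (flux a i 0) + (primitive (fun t => source t i 0)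
      - cst (primitive (fun t => source t i 0) a))); last first.
    by apply/funext => x; rewrite Gdef.
  have cp := continuous_primitive _ (source_integrable alpha _ _ fdf i).
  move=> x; apply: continuousD; first exact: cst_continuous.
  by apply: continuousB; [exact: cp|exact: cst_continuous].
have cv i : continuous (fun x => v x i 0).
  rewrite (_ : (fun x => _) = (cst alpha * (fun x => G x i 0)) - (cst beta *
    ((fun x => f x (i + 1) 0) * (fun x => G x (i + 2%:R) 0)
     - (fun x => f x (i + 2%:R) 0) * (fun x => G x (i + 1) 0)))); last first.
    by apply/funext => x; rewrite !mxE.
  move=> x; apply: continuousB; apply: continuousM; try exact: cst_continuous.
    exact: cG.
  by apply: continuousB; apply: continuousM; (exact: cf || exact: cG).
have cvv : continuous (fun x => dotv (v x) (v x)).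
  apply: (continuous_sum _ _ _ (fun i x => v x i 0 * v x i 0)) => i x.
  by apply: continuousM; exact: cv.
have cH i : continuous (fun x => H x i 0).
  rewrite (_ : (fun x => _) = ((id * cst 2^-1) * (fun x => v x i 0)) -
    ((cst alpha * (fun x => dotv (v x) (v x))) * (fun x => f x i 0))); last first.
    have comb c e (p q : 'cV[R]_3) : (c *: p - e *: q) i 0 = c * p i 0 - e * q i 0.
      by rewrite !mxE.
    by apply/funext => x; rewrite /H comb.
  have c1 (x : R) : {for x, continuous ((id : R -> R) * cst 2^-1)}.
    by apply: (@continuousM _ _ id (cst 2^-1)); [exact: cvg_id|exact: cst_continuous].
  have c2 (x : R) : {for x, continuous (cst alpha * (fun x => dotv (v x) (v x)))}.
    apply: (@continuousM _ _ (cst alpha) (fun x => dotv (v x) (v x))).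
      exact: cst_continuous.
    exact: cvv.
  move=> x; apply: continuousB; apply: continuousM.
  - exact: c1.
  - exact: cv.
  - exact: c2.
  - exact: cf.
have FF := ae_filter_ringOfSetsType mu.
(* Primitives ignore null sets, so [df] and the source may be replaced by continuous functions,
   after which the fundamental theorem holds at every point. *)
have pv i : primitive (fun t => df t i 0) = primitive (fun t => v t i 0).
  apply: primitive_ae_eq; first exact: df_coord_integrable fdf i.
    exact/continuous_segment_integrable/cv.
  by apply: filterS ae_lebesgue_regular => x /dfE ->.
have pH i : primitive (fun t => source t i 0) = primitive (fun t => H t i 0).
  apply: primitive_ae_eq; first exact: source_integrable fdf i.
    exact/continuous_segment_integrable/cH.
  by apply: filterS ae_lebesgue_regular => x /sourceE ->.
exists G => x; split=> [|/=]; apply/is_derive_mxP => i.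
- rewrite (_ : (fun t => _) = cst (f 0 i 0) + primitive (fun t => v t i 0)).
    have D := is_derive_primitive _ x (continuous_segment_integrable _ (cv i)) (cv i x).
    by apply: is_derive_eq; rewrite add0r.
  by apply/funext => t; rewrite (f_increment i 0 t) primitive0 subr0 pv.
- rewrite (_ : (fun t => _) = cst (flux a i 0 - primitive (fun t => H t i 0) a)
      + primitive (fun t => H t i 0)).
    have D := is_derive_primitive _ x (continuous_segment_integrable _ (cH i)) (cH i x).
    by apply: is_derive_eq; rewrite add0r.
  by apply/funext => t; rewrite Gdef pH !fctE; ring.
Qed.

End regularity.

(** * The frame of a regular solution *)

Section strong_solution.
Context {R : realType}.
Variables (alpha beta : R) (f G : R -> 'cV[R]_3).
Hypothesis alpha0 : 0 < alpha.
Hypothesis alphabeta : alpha ^+ 2 + beta ^+ 2 = 1.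
Hypothesis f_unit : forall x, dotv (f x) (f x) = 1.
Let v x := alpha *: G x - beta *: crossv (f x) (G x).
Hypothesis Df : forall x : R, is_derive x 1 f (v x).
Hypothesis DG : forall x : R,
  is_derive x 1 G ((x / 2) *: v x - (alpha * dotv (v x) (v x)) *: f x).

(** Differentiating [|f|^2 = 1] gives [f . v = 0], and [f . v = alpha (f . G)] because [f x G] is
    orthogonal to [f]; one then divides by [alpha > 0]. *)
Lemma dotv_f_G x : dotv (f x) (G x) = 0.
Proof.
have D := is_derive_dotv _ _ _ _ _ (Df x) (Df x).
have E : (fun t => dotv (f t) (f t)) = cst 1 by apply/funext => t; exact: f_unit.
have [_] := D; rewrite E derive_cst (dotvC (v x)).
rewrite /v dotvDr dotvZr dotvNr dotvZr dotv_cross_self mulr0 subr0.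
move=> H; have {}H : alpha * dotv (f x) (G x) = 0 by lra.
by move/eqP: H; rewrite mulf_eq0 gt_eqF//= => /eqP.
Qed.

Lemma v_rotation x : [/\ dotv (v x) (v x) = dotv (G x) (G x),
  dotv (f x) (v x) = 0 & dotv (G x) (v x) = alpha * dotv (G x) (G x)].
Proof. exact: dotv_rotation (dotv_f_G x). Qed.

Definition speed := Num.sqrt (dotv (G 0) (G 0)).

Lemma curvatureM c1 c2 a1 a2 (x : R) :
  curvature c1 a1 x * curvature c2 a2 x = curvature (c1 * c2) (a1 + a2) x.
Proof. by rewrite /curvature mulrACA -expRD; congr (_ * expR _); ring. Qed.

Lemma curvature_exp0 c (x : R) : curvature c 0 x = c.
Proof. by rewrite /curvature !mul0r expR0 mulr1. Qed.

(** [G . G' = (x / 2) (G . v) = (alpha x / 2) |G|^2], since [G . f = 0]. The integrating factor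
    [exp (- alpha x^2 / 2)] is written as a [curvature] with parameter [- 2 alpha], whose derivative
    is known. *)
Lemma dotv_G_G x : dotv (G x) (G x) = curvature speed alpha x ^+ 2.
Proof.
have D (t : R) : is_derive t 1
    (curvature 1 (- (2 * alpha)) * (fun t => dotv (G t) (G t))) 0.
  have D1 := is_derive_curvature 1 (- (2 * alpha)) t.
  have D2 := is_derive_dotv _ _ _ _ _ (DG t) (DG t).
  have [vv fv Gv] := v_rotation t.
  apply: is_derive_eq.
  rewrite (dotvC _ (G t)) dotvDr dotvZr dotvNr dotvZr Gv (dotvC (G t) (f t)).
  by rewrite dotv_f_G /GRing.scale/=; field.
have := is_derive_0_is_cst x 0 D.
rewrite !fctE /curvature expr0n/= mulr0 mul0r expR0 !mul1r => H.
have s2 : speed ^+ 2 = dotv (G 0) (G 0) by rewrite sqr_sqrtr// dotv_ge0.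
rewrite exprMn s2 -H mulrAC -expRM_natl -expRD.
rewrite [X in expR X](_ : _ = 0) ?expR0 ?mul1r//.
by rewrite -mulr_natl; field.
Qed.

Lemma speed0_cst : speed = 0 -> exists w, forall x, f x = w.
Proof.
move=> s0; exists (f 0) => x.
have v0 t : v t = 0.
  apply: dotv_eq0; have [-> _ _] := v_rotation t.
  by rewrite dotv_G_G s0 /curvature mul0r expr0n.
apply/colP => i; apply: (is_derive_0_is_cst x 0 (f := fun t => f t i 0)) => t.
by have /is_derive_mxP/(_ i) := Df t; rewrite v0 mxE.
Qed.

Lemma strong_solution_frenet : 0 < speed -> exists n b,
  frenet (curvature speed alpha) (torsion beta) f n b /\
  forall x, [/\ oriented (f x) (n x) (b x), dotv (n x) (n x) = 1
    & dotv (b x) (b x) = 1].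
Proof.
move=> s0.
have k0 x : 0 < curvature speed alpha x by rewrite mulr_gt0// expR_gt0.
pose k x := curvature speed alpha x.
(* The inverse of [k] is again a curvature function, so it is differentiated by
   [is_derive_curvature]. *)
pose ik x := curvature speed^-1 (- alpha) x.
have kik x : k x * ik x = 1.
  by rewrite /k /ik curvatureM subrr curvature_exp0 divff// gt_eqF.
pose N x := ik x *: G x.
(* This is [f'/|f'|], expressed through the unit vector [N = G/|G|], whose derivative comes from the
   equation for [G]. *)
pose n x := alpha *: N x - beta *: crossv (f x) (N x).
have nE x : n x = ik x *: v x.
  by rewrite /n /N /v crossvZr scalerBr !scalerA ![ik x * _]mulrC.
have vE x : v x = k x *: n x by rewrite nE scalerA kik scale1r.
have NN x : dotv (N x) (N x) = 1.
  rewrite /N dotvZr dotvC dotvZr dotv_G_G -/(k x) expr2.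
  by rewrite mulrA mulrACA !(mulrC (ik x)) kik mulr1.
have fN x : dotv (f x) (N x) = 0 by rewrite dotvZr dotv_f_G mulr0.
have nn x : dotv (n x) (n x) = 1.
  by have [-> _ _] := dotv_rotation _ _ _ _ alphabeta (f_unit x) (fN x).
have fn x : dotv (f x) (n x) = 0.
  by have [_ -> _] := dotv_rotation _ _ _ _ alphabeta (f_unit x) (fN x).
exists n, (fun x => crossv (f x) (n x)).
have nF : n = alpha *: N - beta *: (fun t => crossv (f t) (N t)) by [].
have nFx x : n x = alpha *: N x - beta *: crossv (f x) (N x) by [].
have NE : N = (fun x => ik x *: G x) by [].
(* From here on only the recorded equations unfold [n] and [N], which keeps the derivative
   computations from expanding them. *)
clearbody n N.
have Dn (x : R) : is_derive x 1 n (- k x *: f x + torsion beta x *: crossv (f x) (n x)).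
  have DN : is_derive x 1 N (- (alpha * x / 2) *: N x + (x / 2) *: n x
      - (alpha * k x) *: f x).
    have D1 := is_derive_curvature speed^-1 (- alpha) x.
    rewrite [X in is_derive _ _ X]NE.
    apply: is_derive_eq; first exact: is_derive_scalev D1 (DG x).
    have [vv _ _] := v_rotation x.
    rewrite vv dotv_G_G -/(k x) -/(ik x) vE NE.
    apply/colP => i; rewrite !(addvE,oppvE,scalevE).
    transitivity (- (alpha * x / 2) * (ik x * G x i 0) + x / 2 * (k x * ik x) * n x i 0
       - alpha * (k x * ik x) * k x * f x i 0); first by ring.
    by rewrite kik; ring.
  have DC := is_derive_crossv _ _ _ _ _ (Df x) DN.
  rewrite [X in is_derive _ _ X]nF.
  apply: is_derive_eq.
  by rewrite vE; apply: (frame_derivative _ _ _ _ _ _ (n x) _ alphabeta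
    (f_unit x) (NN x) (fN x) (nFx x)).
split=> [x|x].
  split; first by rewrite -/(k x) -vE.
    exact: Dn.
  (* In [(f x n)' = f' x n + f x n'] the first term vanishes, [f'] being parallel to [n]; in the
     second, only [tau f x (f x n) = - tau n] survives. *)
  apply: is_derive_eq; first exact: is_derive_crossv (Df x) (Dn x).
  rewrite vE crossvC crossvZr crossvv scaler0 oppr0 add0r crossvDr !crossvZr.
  rewrite crossvv scaler0 add0r double_cross fn f_unit scale0r scale1r sub0r.
  by rewrite scalerN -scaleNr.
split=> //; first exact: oriented_frame.
by rewrite dotv_cross_cross f_unit nn fn; ring.
Qed.

End strong_solution.

(** * Frenet curves are weak solutions *)

Section compact_support.
Context {R : realType}.
Local Notation mu := (@lebesgue_measure R).

Lemma smooth_is_derive (V : normedModType R) (g : R -> V) (x : R) :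
  smooth g -> is_derive x 1 g (derive1 g x).
Proof. by move=> sg; rewrite derive1E; apply: derivableP; exact: (sg 0%N). Qed.

Lemma smooth_coord (g : R -> 'cV[R]_3) i : smooth g -> smooth (fun x => g x i 0).
Proof. by move=> /smoothP Cg; apply/smoothP => k; exact: Ck_coord. Qed.

Lemma smooth_continuous (g : R -> R) : smooth g -> continuous g.
Proof. by move=> /smoothP Cg; exact/Ck1_continuous/Cg. Qed.

Lemma smooth_derive (V : normedModType R) (g : R -> V) :
  smooth g -> smooth (derive1 g).
Proof. by move=> sg k x; rewrite -derive1Sn. Qed.

Lemma integral_derive_test_function (g : R -> R) : test_function g ->
  \int[mu]_x derive1 g x = 0.
Proof.
move=> tg; have [sg _] := tg; have [N N0 HN] := test_function_bounded _ _ tg.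
have N1 : 0 <= N + 1 by rewrite addr_ge0.
have out x : N < `|x| -> ~ `[- N, N] x.
  by move=> Nx; rewrite /= in_itv/= -ler_norml leNgt Nx.
(* Enlarged by 1 because [g] is known to vanish only strictly outside [[-N, N]], and its values at
   the endpoints are needed. *)
rewrite (Rintegral_support `[- (N + 1), N + 1]); last first.
  move=> x Nx; have [] := HN x => //; apply: contra_not Nx.
  by rewrite /= !in_itv/= => /andP[? ?]; apply/andP; split; lra.
have NN : - (N + 1) <= N + 1 by lra.
have Dg x := smooth_is_derive _ g x sg.
rewrite (Rintegral_is_derive _ _ _ _ NN Dg); last first.
  exact/smooth_continuous/smooth_derive.
have [-> _] : g (N + 1) = 0 /\ derive1 g (N + 1) = 0.
  by apply/HN/out; rewrite ger0_norm// ltrDl.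
have [-> _] : g (- (N + 1)) = 0 /\ derive1 g (- (N + 1)) = 0.
  by apply/HN/out; rewrite normrN ger0_norm// ltrDl.
by rewrite subrr.
Qed.

Lemma test_function_sub (V : normedModType R) (g : R -> R) (phi : R -> V) :
  smooth g -> (forall x, phi x = 0 -> g x = 0) -> test_function phi ->
  test_function g.
Proof.
move=> sg g0 [_ cphi]; split=> //.
apply: subclosed_compact cphi _; first exact: closed_closure.
by apply: closure_subset => x /=; apply: contra_neq => /g0.
Qed.

Lemma test_function_mul (F psi : R -> R) : smooth F -> test_function psi ->
  test_function (F * psi).
Proof.
move=> sF tpsi; have [spsi _] := tpsi.
apply: (test_function_sub _ _ psi _ _ tpsi); last first.
  by move=> x psix; rewrite fctE psix mulr0.
by apply/smoothP => k; apply: CkM; [move: k; exact/smoothP|move: k; exact/smoothP].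
Qed.

Lemma test_function_dotv (F phi : R -> 'cV[R]_3) : smooth F -> test_function phi ->
  test_function (fun x => dotv (F x) (phi x)).
Proof.
move=> sF tphi; have [sphi _] := tphi.
apply: (test_function_sub _ _ phi _ _ tphi); last first.
  by move=> x ->; rewrite dotvE !mxE; ring.
have -> : (fun x => dotv (F x) (phi x)) =
    (fun x => F x 0 0) * (fun x => phi x 0 0)
    + (fun x => F x 1 0) * (fun x => phi x 1 0)
    + (fun x => F x 2%:R 0) * (fun x => phi x 2%:R 0).
  by apply/funext => x; rewrite dotvE.
apply/smoothP => k.
have C (g : R -> 'cV[R]_3) i : smooth g -> Ck k (fun x => g x i 0).
  by move=> sg; move: k; apply/smoothP; exact: smooth_coord.
by do 2?apply: CkD; apply: CkM; exact: C.
Qed.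

Lemma smooth_integral_by_parts (F psi : R -> R) : smooth F -> test_function psi ->
  \int[mu]_x (F x * derive1 psi x) = - \int[mu]_x (derive1 F x * psi x).
Proof.
move=> sF tpsi; have [spsi _] := tpsi.
have [N N0 HN] := test_function_bounded _ _ tpsi.
have := integral_derive_test_function _ (test_function_mul _ _ sF tpsi).
have DE x : derive1 (F * psi) x = F x * derive1 psi x + derive1 F x * psi x.
  have D1 := smooth_is_derive _ _ x sF; have D2 := smooth_is_derive _ _ x spsi.
  by rewrite derive1E derive_val /GRing.scale/= (mulrC (psi x)).
under eq_Rintegral do rewrite DE.
rewrite !(Rintegral_support `[- N, N]); last 3 first.
- by move=> x /HN[-> _]; rewrite mulr0.
- by move=> x /HN[_ ->]; rewrite mulr0.
- by move=> x /HN[-> ->]; rewrite !mulr0 addr0.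
have cF := smooth_continuous _ sF; have cdF := smooth_continuous _ (smooth_derive _ _ sF).
have cp := smooth_continuous _ spsi; have cdp := smooth_continuous _ (smooth_derive _ _ spsi).
rewrite RintegralD//; first by move=> H; apply/eqP; rewrite -subr_eq0; apply/eqP; lra.
- by apply: continuous_segment_integrable => x; apply: continuousM; [exact: cF|exact: cdp].
- by apply: continuous_segment_integrable => x; apply: continuousM; [exact: cdF|exact: cp].
Qed.

Lemma smooth_L2loc (g : R -> 'cV[R]_3) : smooth g -> L2loc g.
Proof.
move=> sg i; have cg := smooth_continuous _ (smooth_coord _ i sg).
split; first exact: continuous_measurable_fun.
have cg2 : continuous (fun x => g x i 0 ^+ 2).
  under eq_fun do rewrite expr2.
  by move=> x; apply: continuousM; exact: cg.
apply: segment_integrable_locally; first exact: continuous_measurable_fun.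
exact: continuous_segment_integrable.
Qed.

Lemma derive1_coord (g : R -> 'cV[R]_3) i : smooth g ->
  derive1 (fun x => g x i 0) = (fun x => derive1 g x i 0).
Proof.
move=> sg; apply: derive1_eqP => x.
by have /is_derive_mxP := smooth_is_derive _ _ x sg; apply.
Qed.

End compact_support.

Section frenet_weak.
Context {R : realType}.
Variables (alpha beta c : R) (m n b : R -> 'cV[R]_3).
Hypothesis alphabeta : alpha ^+ 2 + beta ^+ 2 = 1.
Hypothesis F : frenet (curvature c alpha) (torsion beta) m n b.
Hypothesis mnb : forall x, oriented (m x) (n x) (b x).
Hypothesis unit0 : dotv (m 0) (m 0) + dotv (n 0) (n 0) + dotv (b 0) (b 0) = 3.
Local Notation mu := (@lebesgue_measure R).

Lemma frenet_orthonormal x :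
  [/\ dotv (m x) (m x) = 1, dotv (n x) (n x) = 1 & dotv (b x) (b x) = 1] /\
  [/\ dotv (m x) (n x) = 0, dotv (m x) (b x) = 0 & dotv (n x) (b x) = 0].
Proof.
apply: oriented_orthonormal; first exact: mnb.
by rewrite (frenet_energy _ _ _ _ _ x F).
Qed.

Lemma frenet_weak_solution : weak_solution alpha beta m.
Proof.
have [sm sn sb] := frenet_smooth _ _ _ _ _ (Ck_curvature c alpha) (Ck_torsion beta) F.
pose k := curvature c alpha.
have dm x : derive1 m x = k x *: n x.
  by rewrite derive1E; have [[]] := F x.
exists (derive1 m).
  split.
  - by move=> x; apply: is_derive_continuous; exact: smooth_is_derive.
  - by move=> x; have [[]] := frenet_orthonormal x.
  - exact: smooth_L2loc.
  - exact/smooth_L2loc/smooth_derive.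
  - move=> i psi tpsi; rewrite smooth_integral_by_parts//; last exact: smooth_coord.
    by rewrite derive1_coord.
move=> phi tphi; have [sphi _] := tphi.
(* Minus the flux: [m' = k n] and [m x n = b] turn [alpha m' + beta m x m'] into
   [k (alpha n + beta b)]. *)
pose g x := (- k x) *: (alpha *: n x + beta *: b x).
have sg : smooth g.
  have CN : forall j, Ck j (- k) by move=> j; exact/CkN/Ck_curvature.
  apply/smoothP => j; apply: (Ck_scalev _ (- k)); first exact: CN.
  apply: (CkD _ (fun x => alpha *: n x) (fun x => beta *: b x)).
    by apply: (Ck_scalev _ (cst alpha)); [exact: Ck_cst|move: j; exact/smoothP].
  by apply: (Ck_scalev _ (cst beta)); [exact: Ck_cst|move: j; exact/smoothP].
have Dg (x : R) : is_derive x 1 g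
    ((alpha * k x ^+ 2) *: m x - (x / 2 * k x) *: n x).
  have [_ Dn Db] := F x.
  have Dk := is_derive_curvature c alpha x.
  have Dv : is_derive x 1 (alpha *: n + beta *: b)
      (alpha *: (- k x *: m x + torsion beta x *: b x)
      + beta *: (- torsion beta x *: n x)).
    exact: is_deriveD.
  have Dk' : is_derive x 1 (- k) (- (alpha * x / 2 * k x)) by exact: is_deriveN.
  apply: is_derive_eq; first exact: is_derive_scalev Dk' Dv.
  apply/colP => i; rewrite !fctE !(addvE,oppvE,scalevE) /torsion.
  (* The components along [b] cancel: the growth of [k] compensates the torsion. Along [n] the two
     effects add up to [alpha^2 + beta^2]. *)
  transitivity (alpha * k x ^+ 2 * m x i 0 -
    (alpha ^+ 2 + beta ^+ 2) * (x / 2 * k x) * n x i 0); first by field.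
  by rewrite alphabeta mul1r.
have := integral_derive_test_function _ (test_function_dotv _ _ sg tphi).
move=> <-; apply: eq_Rintegral => x _.
have Dphi := smooth_is_derive _ _ x sphi.
have [_ D] := is_derive_dotv _ _ _ _ _ (Dg x) Dphi.
rewrite [RHS]derive1E D dm crossvZr.
have [_ _ ->] := mnb x.
have [[_ nn _] _] := frenet_orthonormal x.
have -> : dotv (k x *: n x) (k x *: n x) = k x ^+ 2.
  by rewrite dotvZr dotvC dotvZr nn mulr1.
by rewrite /g !dotvE !(addvE,oppvE,scalevE); ring.
Qed.

End frenet_weak.

Theorem proposition1p2 (R : realType) (alpha beta : R)
  (halpha : 0 < alpha <= 1) (hbeta : beta = Num.sqrt (1 - alpha ^+ 2)) :
  [set f : R -> 'cV[R]_3 |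
     weak_solution alpha beta f /\ ~ (exists v, forall x, f x = v)] =
  [set (fun x : R => Q *m frenet_m c alpha beta x) |
     c in [set c : R | 0 < c] & Q in @SO3 R].
Proof.
have /andP[alpha0 alpha1] := halpha.
have alphabeta : alpha ^+ 2 + beta ^+ 2 = 1.
  have a2 : alpha ^+ 2 <= 1 by rewrite expr_le1// ltW.
  by rewrite hbeta sqr_sqrtr ?subr_ge0// addrC subrK.
apply/seteqP; split=> f /=.
- move=> [[df fdf weak] fncst].
  have [G DG] := weak_solution_C1 _ _ _ _ alphabeta fdf weak.
  have [_ S _ _ _] := fdf.
  have D1 x := (DG x).1; have D2 x := (DG x).2.
  have s0 : 0 < speed G.
    rewrite lt_neqAle sqrtr_ge0 andbT; apply/eqP => s0; apply: fncst.
    exact: speed0_cst alpha0 alphabeta S D1 D2 (esym s0).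
  have [n [b [F FO]]] := strong_solution_frenet _ _ _ _ alpha0 alphabeta S D1 D2 s0.
  have [or0 n1 b1] := FO 0.
  (* [Q] has the initial frame of [f] as columns, so it sends the standard initial frame to it. *)
  have [Q SQ [Q0 Q1 Q2]] := oriented_SO3 _ _ _ or0 (S 0) n1 b1.
  exists (speed G) => //; exists Q => //.
  have [n' [b' [F' [m0 n0 b0]]]] := frenet_mP (speed G) alpha beta.
  have [| | |-> _ _] :=
    frenet_unique _ _ _ _ _ _ _ _ F (frenet_mulmx _ _ _ _ _ Q F').
  + by rewrite m0 -colE.
  + by rewrite n0 -colE.
  + by rewrite b0 -colE.
  + by [].
- move=> [c c0 [Q SQ <-]].
  have [n [b [F [m0 n0 b0]]]] := frenet_mP c alpha beta.
  have FQ := frenet_mulmx _ _ _ _ _ Q F.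
  have or0 : oriented (Q *m frenet_m c alpha beta 0) (Q *m n 0) (Q *m b 0).
    by rewrite m0 n0 b0 -!colE; exact: SO3_oriented.
  have orx := frenet_oriented _ _ _ _ _ FQ or0.
  have [QQ _] := SQ.
  have E i : dotv (col i Q) (col i Q) = 1 by rewrite dotv_colE QQ mxE eqxx.
  have u0 : dotv (Q *m frenet_m c alpha beta 0) (Q *m frenet_m c alpha beta 0)
      + dotv (Q *m n 0) (Q *m n 0) + dotv (Q *m b 0) (Q *m b 0) = 3.
    by rewrite m0 n0 b0 -!colE !E; ring.
  split; first exact: frenet_weak_solution alphabeta FQ orx u0.
  (* The velocity at 0 is [c] times the unit vector [Q n(0)]; for a constant curve it would be zero,
     against [c > 0]. *)
  move=> [v fv].
  have [[_ D] _ _] := FQ 0.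
  have [[_ nn _] _] := frenet_orthonormal _ _ _ _ _ _ FQ orx u0 0.
  have c1 : curvature c alpha 0 = c.
    by rewrite /curvature expr0n/= mulr0 mul0r expR0 mulr1.
  have : (fun x => Q *m frenet_m c alpha beta x) = cst v by apply/funext.
  move=> E0; move: D; rewrite E0 derive_cst c1 => cn.
  have : c * dotv (Q *m n 0) (Q *m n 0) = 0.
    by rewrite -dotvZr -cn dotvE !mxE; ring.
  by rewrite nn mulr1 => c00; move: c0; rewrite c00 ltxx.
Qed.
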